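(* Let $\Omega \subset \mathbb{C}^d$ be a circular domain containing the origin. Let $k,s$ be kernels on $\Omega$ such that $s$ is non-vanishing and $k/s \ge 0$, and let $\mathcal{E}$ be a Hilbert space. Suppose that - $\mathcal{H}_s$ consists of analytic functions on $\Omega$, - the coordinate functions $z_1,\ldots,z_d$ are multipliers of $\mathcal{H}_s$, and - $s(\lambda z, \lambda w) = s(z,w)$ for all $z,w \in \Omega$ and all $\lambda \in \mathbb{T}$. Then a closed subspace $\mathcal{M} \subset \mathcal{H}_k \otimes \mathcal{E}$ is $\operatorname{Mult}(\mathcal{H}_s)$-invariant if and only if it is invariant under multiplication by $z_1,\ldots,z_d$.
   Context: $\mathbb{T}$ is the unit circle in $\mathbb{C}$. A domain $\Omega \subset \mathbb{C}^d$ is circular if $\lambda \Omega \subset \Omega$ for all $\lambda \in \mathbb{T}$. All Hilbert spaces are complex. A kernel on a set $X$ is a positive semi-definite function $k : X \times X \to \mathbb{C}$, i.e. the matrix $[k(x_i,x_j)]$ is positive semi-definite for every finite subset $\{x_1,\dots,x_n\} \subset X$; this is written $k \ge 0$. $\mathcal{H}_k$ denotes the reproducing kernel Hilbert space on $X$ with kernel $k$, so $\langle f, k(\cdot,x)\rangle = f(x)$ for $f \in \mathcal{H}_k$, $x \in X$. $\operatorname{Mult}(\mathcal{H}_k)$ is the algebra of functions $\varphi : X \to \mathbb{C}$ (the multipliers of $\mathcal{H}_k$) with $\varphi \mathcal{H}_k \subset \mathcal{H}_k$, and $M_\varphi$ is the corresponding multiplication operator. $k/s$ denotes the pointwise quotient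 on $X \times X$. Elements of $\mathcal{H}_k \otimes \mathcal{E}$ are regarded as $\mathcal{E}$-valued functions on $X$. If $k/s \ge 0$, then $\operatorname{Mult}(\mathcal{H}_s) \subset \operatorname{Mult}(\mathcal{H}_k)$ contractively; a subspace $\mathcal{M} \subset \mathcal{H}_k \otimes \mathcal{E}$ is $\operatorname{Mult}(\mathcal{H}_s)$-invariant if $(M_\varphi \otimes I)\mathcal{M} \subset \mathcal{M}$ for all $\varphi \in \operatorname{Mult}(\mathcal{H}_s)$. Invariance under multiplication by $z_1,\dots,z_d$ means $(M_{z_j} \otimes I)\mathcal{M} \subset \mathcal{M}$ for $j = 1,\dots,d$. *)

(* Defs.v *)
From HB Require Import structures.
From mathcomp Require Import all_boot all_order all_algebra finmap.
From mathcomp Require Import complex.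
From mathcomp Require Import all_classical all_reals topology normedtype.
From mathcomp Require Import summability.

Set Implicit Arguments.
Unset Strict Implicit.
Unset Printing Implicit Defensive.

Import Order.TTheory GRing.Theory Num.Theory.
Import numFieldNormedType.Exports.

Local Open Scope classical_set_scope.
Local Open Scope ring_scope.
Local Open Scope complex_scope.

(* [R[i]] carries the topology of its norm, as does every [numFieldType] *)
HB.instance Definition _ (R : realType) :=
  PseudoPointedMetric.copy R[i] R[i]^o.
HB.instance Definition _ (R : realType) := GRing.ComAlgebra.copy R[i] R[i]^o.
HB.instance Definition _ (R : realType) := Vector.copy R[i] R[i]^o.
HB.instance Definition _ (R : realType) := NormedModule.copy R[i] R[i]^o.

(* Complex Hilbert spaces; the inner product is linear in its first argument. *)
HB.mixin Record isHilbert (R : realType) H & CompleteNormedModule R[i] H := {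
  inner : {dot H for Num.conj};
  sqr_norm_inner : forall x : H, `|x| ^+ 2 = inner x x
}.

#[short(type="hilbertType")]
HB.structure Definition Hilbert (R : realType) :=
  {H of isHilbert R H & CompleteNormedModule R[i] H}.

Section Kernels.
Variables (R : realType) (X : Type).
Local Notation C := R[i].

Definition is_kernel (k : X -> X -> C) :=
  forall (n : nat) (x : 'I_n -> X) (c : 'I_n -> C),
    0 <= \sum_(i < n) \sum_(j < n) (c i)^* * k (x i) (x j) * c j.

(* [rk_eval] identifies the elements of the space with functions on [X]; that
   it is linear follows from [rk_reproducing].  Any two such spaces for the
   same kernel are isometrically isomorphic via [rk_eval]. *)
Structure rkhs (k : X -> X -> C) := Rkhs {
  rk_space :> hilbertType R;
  rk_eval : rk_space -> X -> C;
  rk_section : X -> rk_space;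
  rk_eval_inj : injective rk_eval;
  rk_sectionE : forall x y, rk_eval (rk_section x) y = k y x;
  rk_reproducing : forall f x, inner f (rk_section x) = rk_eval f x
}.

Definition is_mult_op (k : X -> X -> C) (H : rkhs k) (phi : X -> C)
    (A : H -> H) :=
  forall f x, rk_eval (A f) x = phi x * rk_eval f x.

Definition multiplier (k : X -> X -> C) (H : rkhs k) (phi : X -> C) :=
  forall f : H, exists g : H, forall x, rk_eval g x = phi x * rk_eval f x.

End Kernels.

Structure hilbert_tensor (R : realType) (H E : hilbertType R) := HilbertTensor {
  ht_space :> hilbertType R;
  tens : {bilinear H -> E -> ht_space};
  inner_tens : forall f f' e e',
    inner (tens f e) (tens f' e') = inner f f' * inner e e';
  dense_tens :
    dense (range (fun r : seq (H * E) => \sum_(p <- r) tens p.1 p.2))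
}.

Definition is_tensor_id (R : realType) (H E : hilbertType R)
    (T : hilbert_tensor H E) (A : H -> H) (B : T -> T) :=
  [/\ linear B, continuous B & forall f e, B (tens T f e) = tens T (A f) e].

(* [(M_phi ⊗ I) M ⊂ M]; the operators [M_phi] and [M_phi ⊗ I] are uniquely
   determined, by [rk_eval_inj] and [dense_tens]. *)
Definition invariant_under (R : realType) (X : Type) (k : X -> X -> R[i])
    (H : rkhs k) (E : hilbertType R) (T : hilbert_tensor H E) (M : set T)
    (phi : X -> R[i]) :=
  exists (A : H -> H) (B : T -> T),
    [/\ is_mult_op phi A, is_tensor_id A B & B @` M `<=` M].

Definition mult_invariant (R : realType) (X : Type) (s k : X -> X -> R[i])
    (Hs : rkhs s) (Hk : rkhs k) (E : hilbertType R) (T : hilbert_tensor Hk E)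
    (M : set T) :=
  forall phi, multiplier Hs phi -> invariant_under M phi.

Definition closed_subspace (R : realType) (V : normedModType R[i])
    (M : set V) :=
  closed M /\ GRing.submod_closed [in M].

Section Domains.
Variables (R : realType) (d : nat).
Local Notation C := R[i].
Implicit Type Omega : set 'rV[C]_d.

Definition domain Omega := [/\ Omega !=set0, open Omega & connected Omega].

Definition circular Omega :=
  forall lambda : C, `|lambda| = 1 -> ( *:%R lambda) @` Omega `<=` Omega.

Definition coordinate Omega (j : 'I_d) (z : Omega) : C := val z 0 j.

Definition monomial (alpha : {ffun 'I_d -> nat}) (z : 'rV[C]_d) : C :=
  \prod_(i < d) z 0 i ^+ alpha i.

(* Around each point of [Omega], [f] is the unconditional (equivalently,
   absolute) sum of a power series on a polydisc. *)
Definition analytic Omega (f : Omega -> C) :=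
  forall a : Omega, exists c : {ffun 'I_d -> nat} -> C, exists2 r : C, 0 < r &
    forall z : Omega, (forall i, `|coordinate i z - coordinate i a| < r) ->
      partial_sum (fun alpha => c alpha * monomial alpha (val z - val a))
        @ totally --> f z.

(* The points [lambda z] and [lambda w] of [Omega] are given as [z'], [w']. *)
Definition circle_invariant Omega (s : Omega -> Omega -> C) :=
  forall lambda : C, `|lambda| = 1 -> forall z w z' w' : Omega,
    val z' = lambda *: val z -> val w' = lambda *: val w -> s z' w' = s z w.

End Domains.

Arguments coordinate {R d} Omega j z.

(* Main.v *)
Require Import Defs.
From HB Require Import structures.
From mathcomp Require Import all_boot all_order all_algebra finmap.
From mathcomp Require Import complex.
From mathcomp Require Import all_classical all_reals topology normedtype.
From mathcomp Require Import summability.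
From mathcomp Require Import ring lra zify.

Set Implicit Arguments.
Unset Strict Implicit.
Unset Printing Implicit Defensive.

Import Order.TTheory GRing.Theory Num.Theory.
Import numFieldNormedType.Exports.
Local Open Scope classical_set_scope.
Local Open Scope complex_scope.
Local Open Scope ring_scope.

(** The proof rests on two facts: a multiplier of [Hs] acts on [Hk ⊗ E] with at
    most the norm it has on [Hs], and every multiplier of [Hs] is a pointwise limit
    of polynomials that are bounded in multiplier norm.

    For the first, a function [phi] is a multiplier of [Hs] of norm at most [c]
    exactly when the kernel [(c^2 - phi(x) conj(phi(y))) s(x,y)] is positive
    ([dual_bound_kernel]).  The Schur product with the positive kernel [k/s],
    and then with the Gram kernel of [E], is positive again ([kernel_mul]), so
    [phi] acts on [Hk ⊗ E] with norm at most [c] ([dual_bound_quotient],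
    [dual_bound_tensor]).  Operators are handled through their adjoints, which
    are diagonal on kernel functions, and are recovered from them by Riesz
    representation ([riesz_family]).

    For the second, the polynomials are the Cesaro means of the homogeneous
    expansion of [phi] at the origin, and their norms are controlled by Fejer's
    argument.  Since [s] is invariant under rotations, every rotate
    [z |-> phi(lambda z)] has the multiplier norm of [phi], and convex
    combinations of rotates have at most that norm ([dual_bound_average]).
    Combinations with Fejer weights over finer and finer roots of unity, which
    replace the integral over the circle, converge near the origin to the
    Cesaro means ([cesaro_mean_approx]).  Working near the origin is enough: by the identity
    theorem the kernel functions of points near the origin are total in [Hs]
    ([total_polydisc]), and this propagates both the norm bounds and the
    pointwise limits to all of [Omega] ([polynomial_approximation]).  The
    expansion of [phi] exists because [phi] is in [Hs]: the function [s(., 0)]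
    is constant, so that [Hs] contains the constants
    ([section_origin_constant]).

    Now let [M] be closed and invariant under the coordinates, hence under
    polynomials, and let [F] be in [M].  The products of [F] by the
    approximating polynomials lie in [M], are bounded, and converge to the
    product of [F] by [phi] when tested on the total family [k_x ⊗ e].  Closed
    subspaces are weakly closed ([subspace_weak_closed]), so [phi F] is in [M].
    The converse implication holds because coordinates are multipliers. *)

(** * Real-valued norms and limits of sequences *)

(** Conjugation with codomain [R[i]] itself: the type of [Num.conj z] is that of
    a [numClosedFieldType], so products with it and products of plain complex
    numbers would be taken in ring structures that differ syntactically. *)
Definition cj (R : realType) (z : R[i]) : R[i] := Num.conj z.
HB.instance Definition _ (R : realType) :=
  GRing.RMorphism.copy (@cj R) (Num.conj : R[i] -> R[i]).
Local Notation "z ^*" := (cj z) : ring_scope.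

Section RealNorm.
Variable R : realType.
Local Notation C := R[i].

(** The norm of a normed space over [R[i]] takes values in [R[i]], which is only
    partially ordered; [nrm] is the same norm with values in [R]. *)
Definition nrm (V : normedZmodType C) (x : V) : R := complex.Re `|x|.

Section Zmod.
Variable V : normedZmodType C.
Implicit Types x y : V.

Lemma nrmE x : `|x| = (nrm x)%:C.
Proof. by rewrite /nrm RRe_real// ger0_real. Qed.

Lemma nrm_ge0 x : 0 <= nrm x.
Proof. rewrite -lecR -nrmE; exact: normr_ge0. Qed.

Lemma nrm_le x (r : R) : (nrm x <= r) = (`|x| <= r%:C).
Proof. by rewrite nrmE lecR. Qed.

Lemma nrm_lt x (r : R) : (nrm x < r) = (`|x| < r%:C).
Proof. by rewrite nrmE ltcR. Qed.

Lemma nrmD x y : nrm (x + y) <= nrm x + nrm y.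
Proof. by rewrite nrm_le rmorphD/= -!nrmE ler_normD. Qed.

Lemma nrmN x : nrm (- x) = nrm x.
Proof. by rewrite /nrm normrN. Qed.

Lemma nrmB x y : nrm (x - y) <= nrm x + nrm y.
Proof. by rewrite -(nrmN y) nrmD. Qed.

Lemma nrmC x y : nrm (x - y) = nrm (y - x).
Proof. by rewrite -nrmN opprB. Qed.

Lemma nrm_tri y x z : nrm (x - z) <= nrm (x - y) + nrm (y - z).
Proof. by rewrite -[x - z](subrKA y) nrmD. Qed.

Lemma nrm0 : nrm (0 : V) = 0.
Proof. by rewrite /nrm normr0. Qed.

Lemma nrm_eq0 x : (nrm x == 0) = (x == 0).
Proof. by rewrite -(inj_eq (@complexI R)) -nrmE normr_eq0. Qed.

Lemma nrm_sum (I : Type) (r : seq I) (P : pred I) (F : I -> V) :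
  nrm (\sum_(i <- r | P i) F i) <= \sum_(i <- r | P i) nrm (F i).
Proof.
elim/big_ind2: _ => [|x a y b xa yb|//]; first by rewrite nrm0.
exact: le_trans (nrmD _ _) (lerD xa yb).
Qed.

End Zmod.

Lemma nrmZ (V : normedModType C) (a : C) (x : V) :
  nrm (a *: x) = nrm a * nrm x.
Proof. by apply/complexI; rewrite rmorphM/= -!nrmE normrZ. Qed.

Lemma nrmM (a b : C) : nrm (a * b) = nrm a * nrm b.
Proof. by apply/complexI; rewrite rmorphM/= -!nrmE normrM. Qed.

Lemma nrmX (a : C) n : nrm (a ^+ n) = nrm a ^+ n.
Proof. by apply/complexI; rewrite rmorphXn/= -!nrmE normrX. Qed.

Lemma cjK (a : C) : a^*^* = a.
Proof. exact: conjCK. Qed.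

Lemma cjM (a b : C) : (a * b)^* = a^* * b^*.
Proof. exact: rmorphM. Qed.

Lemma cjD (a b : C) : (a + b)^* = a^* + b^*.
Proof. exact: rmorphD. Qed.

Lemma cjN (a : C) : (- a)^* = - a^*.
Proof. exact: rmorphN. Qed.

Lemma cjX (a : C) n : (a ^+ n)^* = a^* ^+ n.
Proof. exact: rmorphXn. Qed.

Lemma cj_sum (I : Type) (r : seq I) (P : pred I) (F : I -> C) :
  (\sum_(i <- r | P i) F i)^* = \sum_(i <- r | P i) (F i)^*.
Proof. exact: rmorph_sum. Qed.

Lemma nrmJ (a : C) : nrm a^* = nrm a.
Proof. by rewrite /nrm norm_conjC. Qed.

Lemma nrm_real (r : R) : nrm r%:C = `|r|.
Proof. by rewrite /nrm normc_def/= expr0n/= addr0 sqrtr_sqr. Qed.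

Lemma nrm_nat n : nrm (n%:R : C) = n%:R.
Proof. by rewrite /nrm normr_nat -(rmorph_nat (real_complex R)). Qed.

Lemma nrm1 : nrm (1 : C) = 1.
Proof. exact: (nrm_nat 1). Qed.

Lemma sqr_nrm (a : C) : ((nrm a) ^+ 2)%:C = a * a^*.
Proof. by rewrite rmorphXn/= -nrmE normCK. Qed.

Definition cre (z : C) : R := complex.Re z.

Lemma creD a b : cre (a + b) = cre a + cre b.
Proof. by case: a b => ? ? []. Qed.

Lemma creN a : cre (- a) = - cre a.
Proof. by case: a. Qed.

Lemma creZ (t : R) a : cre (t%:C * a) = t * cre a.
Proof. by case: a => a b; rewrite /cre/= mul0r subr0. Qed.

Lemma creJ a : cre a^* = cre a.
Proof. by case: a. Qed.

Lemma cre_le_nrm a : cre a <= nrm a.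
Proof.
rewrite -lecR -nrmE; apply: le_trans (normc_ge_Re a).
by rewrite lecR; exact: ler_norm.
Qed.

Lemma conj_real (t : R) : (t%:C)^* = t%:C.
Proof. by apply/CrealP/complex_realP; exists t. Qed.

Lemma pos_real (z : C) : 0 < z -> z = (cre z)%:C.
Proof. by move=> z0; rewrite /cre RRe_real// gtr0_real. Qed.

Lemma pos_cre (z : C) : 0 < z -> 0 < cre z.
Proof. by move=> z0; rewrite -ltcR -pos_real. Qed.

Lemma harmonic_small (e : R) :
  0 < e -> exists N, forall n, (N <= n)%N -> n.+1%:R^-1 < e.
Proof.
move=> e0; exists (Num.truncn e^-1).+1 => n Nn.
rewrite -[X in _ < X]invrK ltf_pV2 ?posrE ?invr_gt0//.
by rewrite (lt_le_trans (truncnS_gt _))// ler_nat ltnW// ltnS.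
Qed.

Lemma cvg_nrmP (V : normedModType C) (u : nat -> V) (l : V) :
  u @ \oo --> l <->
  forall e : R, 0 < e -> exists N, forall n, (N <= n)%N -> nrm (u n - l) < e.
Proof.
split=> [/cvgrPdist_lt ul e e0|ul].
  have /ul[N _ NP] : 0 < e%:C by rewrite ltcR.
  by exists N => n /NP /=; rewrite -nrm_lt nrmC.
apply/cvgrPdist_lt => e e0; have [N NP] := ul _ (pos_cre e0).
by exists N => // n /= /NP; rewrite nrmC nrm_lt -pos_real.
Qed.

(** Closed balls are closed, in the form used to pass bounds to the limit; only
    a tail of the sequence has to lie in the ball. *)
Lemma nrm_cvg_le (V : normedModType C) (u : nat -> V) (l x : V) (c : R) N :
  u @ \oo --> l -> (forall n, (N <= n)%N -> nrm (u n - x) <= c) ->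
  nrm (l - x) <= c.
Proof.
move=> /cvg_nrmP ul uc; apply/ler_addgt0Pr => e /ul[N' N'P].
apply: le_trans (nrm_tri (u (maxn N N')) _ _) _; rewrite addrC lerD//.
  by rewrite uc// leq_maxl.
by rewrite nrmC ltW// N'P// leq_maxr.
Qed.

Lemma cvg_nrm_unique (V : normedModType C) (u : nat -> V) (l l' : V) :
  u @ \oo --> l -> u @ \oo --> l' -> l = l'.
Proof. by move=> ul ul'; exact: cvg_unique ul ul'. Qed.

Lemma cvg_bigsum (V : normedModType C) (I : Type) (r : seq I)
    (f : I -> nat -> V) (l : I -> V) :
  (forall i, f i @ \oo --> l i) ->
  (fun n => \sum_(i <- r) f i n) @ \oo --> \sum_(i <- r) l i.
Proof.
move=> fl; elim: r => [|i r IH].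
  by under eq_fun do rewrite big_nil; rewrite big_nil; exact: cvg_cst.
by under eq_fun do rewrite big_cons; rewrite big_cons; apply: cvgD IH; exact: fl.
Qed.

Lemma cvg_le_harmonic (V : normedModType C) (u : nat -> V) (l : V) (K : R) :
  (forall n, nrm (u n - l) <= K * n.+1%:R^-1) -> u @ \oo --> l.
Proof.
move=> uK; apply/cvg_nrmP => e e0.
have K1 : 0 < `|K| + 1 by rewrite ltr_wpDl.
have [|N NP] := @harmonic_small (e / (`|K| + 1)); first exact: divr_gt0.
exists N => n /NP; rewrite ltr_pdivlMr// => h; apply: le_lt_trans (uK n) _.
apply: le_lt_trans h; rewrite mulrC ler_wpM2l ?invr_ge0//.
by rewrite (le_trans (ler_norm K))// lerDl.
Qed.

End RealNorm.

(** * Inner products *)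

Section Inner.
Variables (R : realType) (H : hilbertType R).
Local Notation C := R[i].
Implicit Types x y z : H.

Lemma innerDl x y z : inner (x + y) z = inner x z + inner y z.
Proof. by rewrite linearDl. Qed.
Lemma innerBl x y z : inner (x - y) z = inner x z - inner y z.
Proof. by rewrite linearBl. Qed.
Lemma innerZl a x z : inner (a *: x) z = a * inner x z.
Proof. by rewrite linearZl_LR. Qed.
Lemma innerDr x y z : inner z (x + y) = inner z x + inner z y.
Proof. by rewrite linearDr. Qed.
Lemma innerBr x y z : inner z (x - y) = inner z x - inner z y.
Proof. by rewrite linearBr. Qed.
Lemma innerZr a x z : inner z (a *: x) = a^* * inner z x.
Proof. by rewrite linearZr_LR. Qed.
Lemma inner0l z : inner 0 z = 0. Proof. by rewrite linear0l. Qed.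
Lemma inner0r z : inner z 0 = 0. Proof. by rewrite linear0r. Qed.

Lemma inner_suml (I : Type) (r : seq I) (P : pred I) (F : I -> H) z :
  inner (\sum_(i <- r | P i) F i) z = \sum_(i <- r | P i) inner (F i) z.
Proof. exact: (big_morph _ (fun x y => innerDl x y z) (inner0l z)). Qed.
Lemma inner_sumr (I : Type) (r : seq I) (P : pred I) (F : I -> H) z :
  inner z (\sum_(i <- r | P i) F i) = \sum_(i <- r | P i) inner z (F i).
Proof. exact: (big_morph _ (fun x y => innerDr x y z) (inner0r z)). Qed.

Lemma inner_conj x y : (inner x y)^* = inner y x.
Proof. by rewrite [RHS](@hermC _ _ _ _ _)/= expr0 mul1r. Qed.

Lemma inner_nrm x : inner x x = (nrm x ^+ 2)%:C.
Proof. by rewrite -sqr_norm_inner nrmE rmorphXn. Qed.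

Lemma nrm_sqr x : nrm x ^+ 2 = cre (inner x x).
Proof. by rewrite inner_nrm. Qed.

End Inner.

Section InnerNorm.
Variables (R : realType) (H : hilbertType R).
Local Notation C := R[i].
Implicit Types x y z : H.

Lemma nrm_sqrD x y :
  nrm (x + y) ^+ 2 = nrm x ^+ 2 + nrm y ^+ 2 + 2 * cre (inner x y).
Proof.
rewrite !nrm_sqr innerDl !innerDr -(inner_conj x y) !creD creJ; ring.
Qed.

Lemma nrm_sqrB x y :
  nrm (x - y) ^+ 2 = nrm x ^+ 2 + nrm y ^+ 2 - 2 * cre (inner x y).
Proof.
rewrite nrm_sqrD nrmN -scaleN1r innerZr rmorphN1 mulN1r creN; ring.
Qed.

(** This identity makes minimising sequences of convex problems Cauchy. *)
Lemma parallelogram x y :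
  nrm (x - y) ^+ 2 = 2 * nrm x ^+ 2 + 2 * nrm y ^+ 2 - nrm (x + y) ^+ 2.
Proof. by rewrite nrm_sqrB nrm_sqrD; ring. Qed.

Lemma cauchy_schwarz x y : nrm (inner x y) <= nrm x * nrm y.
Proof.
have [->|y0] := eqVneq y 0; first by rewrite inner0r !nrm0 mulr0.
have yp : 0 < nrm y ^+ 2 by rewrite exprn_gt0// lt_def nrm_ge0 nrm_eq0 y0.
rewrite -ler_sqr ?nnegrE ?mulr_ge0 ?nrm_ge0//.
have := sqr_ge0 (nrm ((nrm y ^+ 2)%:C *: x - inner x y *: y)).
rewrite nrm_sqrB !nrmZ innerZl innerZr nrm_real ger0_norm ?sqr_ge0//.
rewrite [_^* * _]mulrC -sqr_nrm -rmorphM/= => h.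
rewrite -(ler_pM2l yp) exprMn.
move: h; set a := nrm (inner x y); set b := nrm y; set c := nrm x => h.
nra.
Qed.

Lemma cauchy_nrm (u : nat -> H) :
  (forall e : R, 0 < e -> exists N, forall n p, (N <= n)%N -> (N <= p)%N ->
    nrm (u n - u p) < e) -> exists l : H, u @ \oo --> l.
Proof.
move=> cu; apply/cvg_ex; apply: cauchy_cvg; apply: cauchy_exP => e e0.
have [N NP] := cu _ (pos_cre e0).
exists (u N), N => // n /= Nn; rewrite -ball_normE /=.
by rewrite (pos_real e0) -nrm_lt; exact: NP.
Qed.

Lemma cvg_inner (u : nat -> H) l z :
  u @ \oo --> l -> (fun n => inner (u n) z) @ \oo --> inner l z.
Proof.
move=> /cvg_nrmP ul; apply/cvg_nrmP => e e0.
have z1 : 0 < nrm z + 1 by rewrite ltr_wpDl ?nrm_ge0.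
have [|N NP] := ul (e / (nrm z + 1)); first exact: divr_gt0.
exists N => n /NP h; rewrite -innerBl.
apply: le_lt_trans (cauchy_schwarz _ _) _.
rewrite ltr_pdivlMr// in h; apply: le_lt_trans h.
by rewrite ler_wpM2l ?nrm_ge0// lerDl.
Qed.

End InnerNorm.

(** * Riesz representation and weak limits *)

Section Families.
Variables (R : realType) (H : hilbertType R) (I : Type).
Local Notation C := R[i].
Implicit Types (v : I -> H) (a : I -> C) (r : seq (C * I)).

(** Finite linear combinations are represented by lists of pairs
    (coefficient, index), which add up by concatenation. *)
Definition comb v r := \sum_(p <- r) p.1 *: v p.2.

Definition total_family v := forall g : H, (forall i, inner g (v i) = 0) -> g = 0.

Definition scale_comb (t : C) r := [seq (t * p.1, p.2) | p <- r].

Lemma comb_cat v r r' : comb v (r ++ r') = comb v r + comb v r'.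
Proof. exact: big_cat. Qed.

Lemma comb_scale v t r : comb v (scale_comb t r) = t *: comb v r.
Proof.
by rewrite /comb big_map scaler_sumr; under eq_bigr do rewrite /= -scalerA.
Qed.

Lemma inner_comb g v r :
  inner g (comb v r) = \sum_(p <- r) p.1^* * inner g (v p.2).
Proof. by rewrite inner_sumr; under eq_bigr do rewrite innerZr. Qed.

(** The moment problem [<g, v_i> = a_i] is solvable as soon as the conjugate
    linear functional [sum u_i v_i |-> sum conj(u_i) a_i] is bounded.  The
    bound implies that [J(x) = ||x||^2 - 2 Re (functional of x)] is bounded
    below on the span of [v], and the parallelogram identity makes every
    minimising sequence Cauchy; its limit solves the problem because [J]
    cannot decrease in any direction [v_i].  The last conclusion, that [g] is
    in the closed span, gives orthogonal projections: apply the theorem to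
    all vectors of a subspace. *)
Theorem riesz_family v a (c : R) :
  0 <= c ->
  (forall r, nrm (\sum_(p <- r) p.1^* * a p.2) <= c * nrm (comb v r)) ->
  exists g : H, [/\ forall i, inner g (v i) = a i, nrm g <= c &
    forall e : R, 0 < e -> exists r, nrm (g - comb v r) < e].
Proof.
move=> c0 ac; pose lin r := \sum_(p <- r) p.1^* * a p.2.
have lin_cat r r' : lin (r ++ r') = lin r + lin r' by exact: big_cat.
have lin_scale t r : lin (scale_comb t r) = t^* * lin r.
  rewrite /lin big_map mulr_sumr; apply: eq_bigr => p _ /=.
  by rewrite rmorphM mulrA.
pose J r := nrm (comb v r) ^+ 2 - 2 * cre (lin r).
have Jge r : - c ^+ 2 <= J r.
  have := cre_le_nrm (lin r); have := ac r; rewrite -/(lin r).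
  rewrite /J; have := sqr_ge0 (nrm (comb v r) - c); nra.
have Jinf : has_inf (range J).
  by split; [exists (J [::]), [::] | exists (- c ^+ 2) => _ [r _ <-]].
pose m := inf (range J).
have Jm r : m <= J r by apply: ge_inf; [case: Jinf | exists r].
have Jmin (n : nat) : exists r, J r < m + n.+1%:R^-1.
  have [|_ [r _ <-] h] := @inf_adherent _ _ n.+1%:R^-1 _ Jinf.
    by rewrite invr_gt0.
  by exists r.
have [r rP] := choice Jmin.
pose h n := comb v (r n).
have dist n p : nrm (h n - h p) ^+ 2 <= 2 * n.+1%:R^-1 + 2 * p.+1%:R^-1.
  have := Jm (scale_comb (2^-1 : R)%:C (r n ++ r p)).
  rewrite /J comb_scale lin_scale comb_cat lin_cat parallelogram nrmZ.
  rewrite conj_real nrm_real ger0_norm ?invr_ge0// creZ creD exprMn.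
  have -> : (2^-1 : R) ^+ 2 = 4^-1 by field.
  have := rP n; have := rP p; rewrite /J -/(h n) -/(h p).
  by move: n.+1%:R^-1 p.+1%:R^-1 => x y; lra.
have [g hg] : exists g : H, h @ \oo --> g.
  apply: cauchy_nrm => e e0.
  have e2 : 0 < e ^+ 2 by rewrite exprn_gt0.
  have [|N inv_lt] := @harmonic_small _ (e ^+ 2 / 4); first by rewrite divr_gt0.
  exists N => n p Nn Np.
  have := dist n p; have := inv_lt _ Nn; have := inv_lt _ Np => h1 h2 h3.
  have : nrm (h n - h p) ^+ 2 < e ^+ 2.
    apply: le_lt_trans h3 _; move: h1 h2.
    by move: n.+1%:R^-1 p.+1%:R^-1 (e ^+ 2) => x y z; lra.
  by rewrite ltr_sqr ?nnegrE ?nrm_ge0// ltW.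
have appr e : 0 < e -> exists r, nrm (g - comb v r) < e.
  move: hg => /cvg_nrmP hg /hg[N /(_ N (leqnn N)) hN].
  by exists (r N); rewrite nrmC.
have gi i : inner g (v i) = a i.
  have bnd n : nrm (inner (h n) (v i) - a i) ^+ 2 <=
      (nrm (v i) ^+ 2 + 1) * n.+1%:R^-1.
    set b := inner (h n) (v i) - a i; set V := nrm (v i) ^+ 2.
    have V0 : 0 <= V by rewrite sqr_ge0.
    pose t : R := (V + 1)^-1; have V1 : 0 < V + 1 by rewrite ltr_wpDl.
    have tV : t * V = 1 - t.
      by rewrite -[X in X - _](mulVf (lt0r_neq0 V1)) -/t; ring.
    have t0 : 0 < t by rewrite invr_gt0.
    (* The direction of steepest descent of [J] along [v i]. *)
    pose w := - (t%:C * b).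
    have := Jm (r n ++ [:: (w, i)]).
    rewrite /J comb_cat lin_cat {2}/comb {2}/lin !big_seq1 /= nrm_sqrD nrmZ.
    rewrite innerZr -/(h n) => Jw.
    have cw : cre (w^* * inner (h n) (v i)) - cre (w^* * a i) = - t * nrm b ^+ 2.
      rewrite -creN -creD -mulrN -mulrDr -/b /w cjN cjM conj_real.
      rewrite mulNr -mulrA creN creZ [b^* * b]mulrC -sqr_nrm.
      by rewrite mulNr.
    have nw : nrm w = t * nrm b by rewrite nrmN nrmM nrm_real gtr0_norm.
    have : t * nrm b ^+ 2 <= n.+1%:R^-1.
      have := rP n; move: Jw; rewrite /J -/(h n) creD nw !exprMn -/V.
      move: cw n.+1%:R^-1; set x := cre _; set y := cre (_ * a i) => cw z.
      have : t ^+ 2 * nrm b ^+ 2 * V = (1 - t) * t * nrm b ^+ 2.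
        by rewrite -tV; ring.
      have := mulr_ge0 (sqr_ge0 t) (sqr_ge0 (nrm b)).
      move: (cre (lin (r n))) (nrm (h n) ^+ 2) => l n2; lra.
    by rewrite -ler_pdivrMl.
  have hva : (fun n => inner (h n) (v i)) @ \oo --> a i.
    apply/cvg_nrmP => e e0; set V := nrm (v i) ^+ 2 + 1 in bnd.
    have V0 : 0 < V by rewrite ltr_wpDl ?sqr_ge0.
    have [|N NP] := @harmonic_small _ (e ^+ 2 / V).
      by rewrite divr_gt0 ?exprn_gt0.
    exists N => n /NP; rewrite ltr_pdivlMr// mulrC => /(le_lt_trans (bnd n)).
    by rewrite ltr_sqr ?nnegrE ?nrm_ge0// ltW.
  exact: cvg_nrm_unique (cvg_inner hg) hva.
exists g; split=> //.
have key e : 0 < e -> nrm g ^+ 2 <= nrm g * c + e.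
  move=> e0; have gc : 0 < nrm g + c + 1 by rewrite ltr_wpDl ?addr_ge0 ?nrm_ge0.
  have [|q qP] := appr (e / (nrm g + c + 1)); first exact: divr_gt0.
  have : nrm (inner g (comb v q)) <= c * nrm (comb v q).
    by rewrite inner_comb; under eq_bigr do rewrite gi; exact: ac.
  have := cre_le_nrm (inner g (comb v q)).
  have := cre_le_nrm (inner g (g - comb v q)).
  have := cauchy_schwarz g (g - comb v q).
  have -> : cre (inner g (comb v q)) = nrm g ^+ 2 - cre (inner g (g - comb v q)).
    by rewrite innerBr creD creN nrm_sqr opprB addrC subrK.
  have : nrm (comb v q) <= nrm g + nrm (g - comb v q).
    by rewrite nrmC -{1}[comb v q](subrKC g) nrmD.
  move: qP; rewrite ltr_pdivlMr//.
  have := nrm_ge0 g; have := nrm_ge0 (g - comb v q); nra.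
have : nrm g ^+ 2 <= nrm g * c by apply/ler_addgt0Pr => e; exact: key.
have := nrm_ge0 g; rewrite le_eqVlt => /predU1P[<-//|g0].
by rewrite expr2 ler_pM2l.
Qed.

End Families.

Section Total.
Variables (R : realType) (H : hilbertType R) (I : Type).
Local Notation C := R[i].
Implicit Types (v : I -> H) (a : I -> C) (r : seq (C * I)).

Lemma nrm_inner_comb_le (w : H) v r :
  nrm (\sum_(p <- r) p.1^* * inner w (v p.2)) <= nrm w * nrm (comb v r).
Proof. by rewrite -inner_comb cauchy_schwarz. Qed.

(** The projection of [w] to the closed span of [v], given by [riesz_family],
    differs from [w] by a vector orthogonal to [v], that is by 0. *)
Lemma total_dense v : total_family v ->
  forall (w : H) (e : R), 0 < e -> exists r, nrm (w - comb v r) < e.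
Proof.
move=> tv w; have [g [gv _ gapp]] :=
  riesz_family (a := fun i => inner w (v i)) (nrm_ge0 w) (nrm_inner_comb_le w v).
suff -> : w = g by [].
apply/eqP; rewrite -subr_eq0; apply/eqP/tv => i.
by rewrite innerBl gv subrr.
Qed.

Lemma inner_ext v (g h : H) : total_family v ->
  (forall i, inner g (v i) = inner h (v i)) -> g = h.
Proof.
move=> tv gh; apply/eqP; rewrite -subr_eq0; apply/eqP/tv => i.
by rewrite innerBl gh subrr.
Qed.

(** For a bounded sequence, weak convergence can be tested on a total family:
    [w] is close to a combination of the [v_i], uniformly in the sequence. *)
Lemma cvg_inner_total v (u : nat -> H) (x : H) (K : R) : total_family v ->
  (forall n, nrm (u n) <= K) ->
  (forall i, (fun n => inner (u n) (v i)) @ \oo --> inner x (v i)) ->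
  forall w, (fun n => inner (u n) w) @ \oo --> inner x w.
Proof.
move=> tv uK ux w; apply/cvg_nrmP => e e0.
have K1 : 0 < K + nrm x + 1.
  by rewrite ltr_wpDl// addr_ge0 ?nrm_ge0// (le_trans _ (uK 0%N)) ?nrm_ge0.
have [|r rP] := total_dense tv w (e := e / 2 / (K + nrm x + 1)).
  by rewrite !divr_gt0.
have : (fun n => inner (u n) (comb v r)) @ \oo --> inner x (comb v r).
  rewrite inner_comb; under eq_fun do rewrite inner_comb.
  by apply: cvg_bigsum => p; apply: cvgMl_tmp.
move=> /cvg_nrmP/(_ (e / 2)) [|N NP]; first by rewrite divr_gt0.
exists N => n /NP; rewrite -!innerBl => h.
rewrite -(subrK (comb v r) w) innerDr.
apply: le_lt_trans (nrmD _ _) _; rewrite [ltRHS]splitr ler_ltD//.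
apply: le_trans (cauchy_schwarz _ _) _.
move: rP; rewrite ltr_pdivlMr// mulrC => /ltW; apply: le_trans.
rewrite ler_wpM2r ?nrm_ge0// (le_trans (nrmB _ _))//.
by have := uK n; lra.
Qed.

End Total.

Section ClosedSubspace.
Variables (R : realType) (H : hilbertType R) (M : set H).
Hypothesis Mc : closed_subspace M.
Local Notation C := R[i].

Lemma subspace0 : M 0.
Proof. by case: Mc => _ [] /set_mem. Qed.

Lemma subspaceP (a : C) x y : M x -> M y -> M (a *: x + y).
Proof.
by case: Mc => _ [_ h] Mx My; apply/set_mem/h; exact: mem_set.
Qed.

Lemma subspaceD x y : M x -> M y -> M (x + y).
Proof. by move=> Mx My; rewrite -[x]scale1r; exact: subspaceP. Qed.

Lemma subspaceZ (a : C) x : M x -> M (a *: x).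
Proof. by move=> Mx; rewrite -[_ *: x]addr0; apply: subspaceP subspace0. Qed.

Lemma subspace_adh x :
  (forall e : R, 0 < e -> exists2 y, M y & nrm (x - y) < e) -> M x.
Proof.
move=> h; case: Mc => cM _; apply: cM => B /nbhs_normP [e e0 eB].
have [y My xy] := h _ (pos_cre e0).
by exists y; split=> //; apply: eB => /=; rewrite (pos_real e0) -nrm_lt.
Qed.

(** Let [g] be the projection of [x] to [M].  Then [x - g] is orthogonal to all
    [u n], hence to their weak limit [x]; being also orthogonal to [g], it is
    orthogonal to itself. *)
Lemma subspace_weak_closed (I : Type) (v : I -> H) (u : nat -> H) x (K : R) :
  total_family v -> (forall n, M (u n)) -> (forall n, nrm (u n) <= K) ->
  (forall i, (fun n => inner (u n) (v i)) @ \oo --> inner x (v i)) -> M x.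
Proof.
move=> tv Mu uK ux.
pose incl (y : {y | M y}) := sval y.
have [g [gx _ gapp]] := 
  riesz_family (a := fun y => inner x (incl y)) (nrm_ge0 x) (nrm_inner_comb_le x incl).
have Mg : M g.
  apply: subspace_adh => e /gapp[r rP]; exists (comb incl r) => //.
  rewrite /comb; elim: r {rP} => [|p r IH]; first by rewrite big_nil; exact: subspace0.
  by rewrite big_cons; apply: subspaceP => //; case: p.2.
have orth y : M y -> inner y (x - g) = 0.
  move=> My; rewrite -inner_conj innerBl.
  by have /= -> := gx (exist _ y My); rewrite subrr rmorph0.
have xorth : inner x (x - g) = 0.
  have := cvg_inner_total tv uK ux (w := x - g).
  under eq_fun do rewrite orth//.
  by move=> u0; apply: cvg_nrm_unique u0 _; exact: cvg_cst.
suff -> : x = g by [].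
apply/eqP; rewrite -subr_eq0 -nrm_eq0 -sqrf_eq0 nrm_sqr innerBl xorth.
by rewrite orth// subrr.
Qed.

End ClosedSubspace.

(** * Uniform boundedness *)

Section UniformBoundedness.
Variables (R : realType) (H : hilbertType R).

(** Uniform boundedness by a gliding hump.  If the norms of [g n] in [G] grow
    fast enough, a point [x n] is moved at step [n] by a distance [3^-(n+1)]
    in the direction of [g n], with the sign that makes [<x, g n>] large.  All
    later moves together amount to at most half that distance, so they cannot
    undo the gain, and the limit point is not weakly bounded on [G]. *)
Theorem weakly_bounded (G : set H) :
  (forall f : H, exists K : R, forall g, G g -> nrm (inner f g) <= K) ->
  exists K : R, forall g, G g -> nrm g <= K.
Proof.
move=> wb; apply: contrapT => nb.
have big (K : R) : exists g, G g /\ K < nrm g.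
  apply: contrapT => h; apply: nb; exists K => g Gg; rewrite leNgt.
  by apply/negP => Kg; apply: h; exists g.
have [g gP] := choice (fun n : nat => big (2 * n%:R * 3 ^+ n.+1)).
have Gg n : G (g n) by case: (gP n).
have gn n : 2 * n%:R * 3 ^+ n.+1 < nrm (g n) by case: (gP n).
have g0 n : 0 < nrm (g n).
  by apply: le_lt_trans (gn n); rewrite !mulr_ge0 ?exprn_ge0.
have p3 n : 0 < 3 ^- n :> R by rewrite invr_gt0 exprn_gt0.
have jump n x : exists y : H, nrm (y - x) <= 3 ^- n.+1 /\
    3 ^- n.+1 * nrm (g n) <= nrm (inner y (g n)).
  pose w := (3 ^- n.+1 / nrm (g n))%:C *: g n.
  have t0 : 0 <= 3 ^- n.+1 / nrm (g n) by rewrite divr_ge0 ?nrm_ge0// ltW.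
  have nw : nrm w = 3 ^- n.+1.
    by rewrite nrmZ nrm_real ger0_norm// divfK// gt_eqF.
  have iw : nrm (inner w (g n)) = 3 ^- n.+1 * nrm (g n).
    rewrite innerZl inner_nrm -rmorphM/= nrm_real.
    rewrite ger0_norm; last exact: mulr_ge0 t0 (sqr_ge0 _).
    by rewrite expr2 mulrA divfK// gt_eqF.
  have [h|h] := leP (3 ^- n.+1 * nrm (g n)) (nrm (inner (x + w) (g n))).
    by exists (x + w); rewrite addrAC subrr add0r nw.
  exists (x - w); rewrite addrAC subrr add0r nrmN nw; split=> //.
  move: h; rewrite -iw => h.
  have : nrm (inner (x + w) (g n) - inner (x - w) (g n)) = 2 * nrm (inner w (g n)).
    rewrite -innerBl opprB addrC addrA subrK -mulr2n -scaler_nat innerZl nrmM.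
    by rewrite nrm_nat.
  have := nrmB (inner (x + w) (g n)) (inner (x - w) (g n)); lra.
have [step stepP] := choice (fun p : nat * H => jump p.1 p.2).
pose x := fix x n := if n is n'.+1 then step (n', x n') else 0.
have dx n : nrm (x n.+1 - x n) <= 3 ^- n.+1 by case: (stepP (n, x n)).
have dxk n k : nrm (x (n + k)%N - x n) <= (3 ^- n - 3 ^- (n + k)) / 2.
  elim: k => [|k IH]; first by rewrite addn0 !subrr nrm0 mul0r.
  apply: le_trans (nrm_tri (x (n + k)%N) _ _) _.
  have := dx (n + k)%N; rewrite addnS exprS invfM; move: IH.
  move: (3 ^- n) (3 ^- (n + k)) => a b; lra.
have dxle n k : (n <= k)%N -> nrm (x k - x n) <= 3 ^- n / 2.
  move=> /subnKC <-; apply: le_trans (dxk _ _) _.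
  by rewrite ler_pM2r ?invr_gt0// gerBl ltW.
have small n : 3 ^- n <= n.+1%:R^-1 :> R.
  by rewrite lef_pV2 ?posrE ?exprn_gt0// -natrX ler_nat ltn_expl.
have [l xl] : exists l : H, x @ \oo --> l.
  apply: cauchy_nrm => e /harmonic_small[N NP]; exists N => n p Nn Np.
  apply: le_lt_trans (nrm_tri (x N) _ _) _.
  rewrite [nrm (x N - _)]nrmC.
  have := dxle _ _ Nn; have := dxle _ _ Np; have := small N.
  by have := NP _ (leqnn N); move: N.+1%:R^-1 (3 ^- N) => a b; lra.
have far n : n%:R <= nrm (inner l (g n)).
  have : nrm (l - x n.+1) <= 3 ^- n.+1 / 2 by apply: nrm_cvg_le xl (dxle n.+1).
  have [_ /=] := stepP (n, x n); rewrite -/(x n.+1) => h1 h2.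
  have := cauchy_schwarz (x n.+1 - l) (g n).
  have := nrmD (inner (x n.+1 - l) (g n)) (inner l (g n)).
  rewrite -innerDl subrK nrmC => h3 h4.
  have := ler_wpM2r (nrm_ge0 (g n)) h2.
  have : n%:R <= 3 ^- n.+1 / 2 * nrm (g n).
    rewrite mulrAC ler_pdivlMr// -ler_pdivrMl// invrK.
    by rewrite mulrC [n%:R * 2]mulrC ltW.
  lra.
have [K KP] := wb l.
have := far (Num.truncn K).+1; have := KP _ (Gg (Num.truncn K).+1).
have := truncnS_gt K; lra.
Qed.

End UniformBoundedness.

(** * Diagonal operators bounded through their adjoints *)

Section DualBound.
Variables (R : realType) (H : hilbertType R) (I : Type).
Local Notation C := R[i].
Implicit Types (v : I -> H) (a : I -> C) (r : seq (C * I)).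

Definition twist a r := [seq (p.1 * (a p.2)^*, p.2) | p <- r].

(** The operator [A] with [<A F, v_i> = a_i <F, v_i>] is multiplication by [a]
    when the [v_i] are the kernel functions.  Its adjoint is diagonal,
    [v_i |-> conj(a_i) v_i], so that [||A|| <= c] can be stated on finite
    combinations, before [A] is known to exist: this is [dual_bound v a c]. *)
Definition dual_bound v a (c : R) :=
  forall r, nrm (comb v (twist a r)) <= c * nrm (comb v r).

Lemma inner_twist (F : H) v a r :
  inner F (comb v (twist a r)) =
  \sum_(p <- r) p.1^* * (a p.2 * inner F (v p.2)).
Proof.
rewrite inner_comb big_map; apply: eq_bigr => p _ /=.
by rewrite cjM cjK mulrA.
Qed.

(** The converse of [op_dual_bound]: a bounded adjoint on the span of [v] is
    enough to construct the operator, by [riesz_family]. *)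
Lemma dual_bound_op v a c : 0 <= c -> dual_bound v a c ->
  forall F : H, exists G : H,
    (forall i, inner G (v i) = a i * inner F (v i)) /\ nrm G <= c * nrm F.
Proof.
move=> c0 ac F.
have [|r|G [Gv Gc _]] := @riesz_family _ _ _ v (fun i => a i * inner F (v i))
  (c * nrm F).
- by rewrite mulr_ge0 ?nrm_ge0.
- rewrite -inner_twist (le_trans (cauchy_schwarz _ _))// mulrC -mulrA.
  rewrite [nrm F * _]mulrC mulrA.
  by rewrite ler_wpM2r ?nrm_ge0.
- by exists G.
Qed.

(** If [h] is a combination and [h'] its image under the adjoint, then
    [||h'||^2 = <A h', h>], whence [||h'||^2 <= c ||h'|| ||h||]. *)
Lemma op_dual_bound v a c : 0 <= c ->
  (forall F : H, exists G : H,
    (forall i, inner G (v i) = a i * inner F (v i)) /\ nrm G <= c * nrm F) ->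
  dual_bound v a c.
Proof.
move=> c0 op r; have [G [Gv Gc]] := op (comb v (twist a r)).
have key : inner G (comb v r) = (nrm (comb v (twist a r)) ^+ 2)%:C.
  rewrite -inner_nrm inner_twist inner_comb.
  by apply: eq_bigr => p _; rewrite Gv.
have := cauchy_schwarz G (comb v r); rewrite key nrm_real ger0_norm ?sqr_ge0//.
have := nrm_ge0 (comb v (twist a r)); rewrite le_eqVlt => /predU1P[<- _|h0 h].
  by rewrite mulr_ge0 ?nrm_ge0.
rewrite -(ler_pM2l h0) -expr2 (le_trans h)//.
by rewrite mulrCA mulrA ler_wpM2r ?nrm_ge0.
Qed.

End DualBound.

Section DualBoundClosure.
Variables (R : realType) (H : hilbertType R) (I : Type).
Local Notation C := R[i].
Implicit Types (v : I -> H) (a : I -> C) (c : R).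

Lemma dual_bound_sub (J : Type) (iota : J -> I) v a c :
  dual_bound v a c -> dual_bound (v \o iota) (a \o iota) c.
Proof.
move=> b r; have := b [seq (p.1, iota p.2) | p <- r].
by rewrite /comb /twist -map_comp !big_map.
Qed.

Lemma dual_bound_lim v (a : nat -> I -> C) (l : I -> C) c :
  (forall n, dual_bound v (a n) c) ->
  (forall i, (fun n => a n i) @ \oo --> l i) -> dual_bound v l c.
Proof.
move=> b al r; rewrite -[comb v (twist l r)]subr0.
apply: (@nrm_cvg_le _ _ (fun n => comb v (twist (a n) r)) _ _ _ 0%N); first last.
- by move=> n _; rewrite subr0; exact: b.
rewrite /comb big_map; under eq_fun do rewrite /comb big_map.
apply: cvg_bigsum => p /=; apply: cvgZr_tmp; apply: cvgMl_tmp.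
apply/cvg_nrmP => e /((cvg_nrmP _ _).1 (al p.2))[N NP].
by exists N => n /NP; rewrite -nrmJ cjD cjN.
Qed.

Lemma dual_bound_convex v N (w : 'I_N -> R) (a : 'I_N -> I -> C) c :
  (forall j, 0 <= w j) -> \sum_j w j = 1 -> (forall j, dual_bound v (a j) c) ->
  dual_bound v (fun i => \sum_j (w j)%:C * a j i) c.
Proof.
move=> w0 w1 b r.
have -> : comb v (twist (fun i => \sum_j (w j)%:C * a j i) r) =
    \sum_j (w j)%:C *: comb v (twist (a j) r).
  rewrite /comb !big_map.
  under [RHS]eq_bigr do rewrite /comb big_map scaler_sumr.
  rewrite exchange_big; apply: eq_bigr => p _ /=.
  rewrite cj_sum mulr_sumr scaler_suml; apply: eq_bigr => j _.
  by rewrite cjM conj_real mulrCA scalerA.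
apply: le_trans (nrm_sum _ _ _) _; rewrite -[leRHS]mul1r -w1 mulr_suml.
apply: ler_sum => j _; rewrite nrmZ nrm_real ger0_norm// ler_wpM2l//.
exact: b.
Qed.

(** When a total subfamily sees the bound [c], the operator constructed from it
    has norm at most [c] and agrees with the given one, so the whole family
    sees the same bound. *)
Lemma dual_bound_extend (J : Type) (iota : J -> I) v a c : 0 <= c ->
  total_family (v \o iota) -> dual_bound (v \o iota) (a \o iota) c ->
  (forall F : H, exists G : H, forall i, inner G (v i) = a i * inner F (v i)) ->
  dual_bound v a c.
Proof.
move=> c0 tv b op; apply: op_dual_bound => // F.
have [G GP] := op F; have [G' [G'P G'c]] := dual_bound_op c0 b F.
exists G; split=> //; suff -> : G = G' by [].
by apply: (inner_ext tv) => j; rewrite G'P GP.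
Qed.

End DualBoundClosure.

(** * Positive kernels *)

Section Kernels.
Variables (R : realType) (X : Type).
Local Notation C := R[i].
Implicit Type k : X -> X -> C.

Lemma kernelP k : is_kernel k <-> forall r : seq (C * X),
  0 <= \sum_(p <- r) \sum_(q <- r) p.1^* * k p.2 q.2 * q.1.
Proof.
split=> [kk r|kk n x c].
  rewrite big_tnth; under eq_bigr do rewrite big_tnth.
  exact: (kk (size r) (fun i => (tnth (in_tuple r) i).2)
    (fun i => (tnth (in_tuple r) i).1)).
have := kk [seq (c i, x i) | i <- enum 'I_n].
rewrite big_map big_enum/=.
by under eq_bigr do rewrite big_map big_enum.
Qed.

Lemma kernel_ext k k' : (forall x y, k x y = k' x y) -> is_kernel k -> is_kernel k'.
Proof. by move=> /funeq2P ->. Qed.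

Lemma kernel_comp (Y : Type) (f : Y -> X) k :
  is_kernel k -> is_kernel (fun x y => k (f x) (f y)).
Proof. by move=> kk n x c; exact: (kk n (f \o x) c). Qed.

Lemma comb_gram (H : hilbertType R) (v : X -> H) (r : seq (C * X)) :
  inner (comb v r) (comb v r) =
  \sum_(p <- r) \sum_(q <- r) p.1^* * inner (v q.2) (v p.2) * q.1.
Proof.
rewrite inner_comb; apply: eq_bigr => p _.
rewrite inner_suml mulr_sumr; apply: eq_bigr => q _.
by rewrite innerZl mulrA mulrAC.
Qed.

Lemma gram_kernel (H : hilbertType R) (v : X -> H) :
  is_kernel (fun x y => inner (v y) (v x)).
Proof.
apply/kernelP => r; rewrite -comb_gram inner_nrm.
by rewrite -[0]/((0 : R)%:C) lecR sqr_ge0.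
Qed.

(** The difference of the squares of the two sides of the inequality in
    [dual_bound] is the quadratic form of this kernel: contractivity of
    multiplication becomes positivity, to which the Schur product applies. *)
Lemma dual_bound_kernel (H : hilbertType R) (v : X -> H) (a : X -> C) (c : R) :
  0 <= c -> dual_bound v a c <->
  is_kernel (fun x y => ((c ^+ 2)%:C - a x * (a y)^*) * inner (v y) (v x)).
Proof.
move=> c0.
have key r : \sum_(p <- r) \sum_(q <- r) p.1^* *
    (((c ^+ 2)%:C - a p.2 * (a q.2)^*) * inner (v q.2) (v p.2)) * q.1 =
    ((c * nrm (comb v r)) ^+ 2 - nrm (comb v (twist a r)) ^+ 2)%:C.
  rewrite rmorphB/= exprMn [X in X - _]rmorphM/= -!inner_nrm !comb_gram.
  rewrite big_map mulr_sumr -sumrB; apply: eq_bigr => p _.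
  rewrite big_map mulr_sumr -sumrB; apply: eq_bigr => q _ /=.
  by rewrite cjM cjK; ring.
have eqv r : (nrm (comb v (twist a r)) <= c * nrm (comb v r)) =
    (0 <= (((c * nrm (comb v r)) ^+ 2 - nrm (comb v (twist a r)) ^+ 2)%:C : C)).
  by rewrite -[0]/((0 : R)%:C) lecR subr_ge0 ler_sqr ?nnegrE ?mulr_ge0 ?nrm_ge0.
split=> [av|/kernelP ak r]; last by rewrite eqv -key.
by apply/kernelP => r; rewrite key -eqv.
Qed.

(** Positivity on the pairs of coefficients [(1, 1)] and [(1, i)] forces the
    off-diagonal entries to be conjugate. *)
Lemma kernel_herm k : is_kernel k -> forall x y, k y x = (k x y)^*.
Proof.
move=> /kernelP kk.
have cj_ge0 (z : C) : 0 <= z -> z^* = z by exact: geC0_conj.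
have cj1 : (1 : C)^* = 1 by exact: rmorph1.
have diag z : (k z z)^* = k z z.
  by apply: cj_ge0; have := kk [:: (1, z)]; rewrite !big_seq1 /= cj1 mul1r mulr1.
have two t x y : (k x x + k x y * t + (t^* * k y x + t^* * k y y * t))^* =
    k x x + k x y * t + (t^* * k y x + t^* * k y y * t).
  apply: cj_ge0; have := kk [:: (1, x); (t, y)].
  by rewrite !big_cons !big_nil /= cj1 !mulr1 !mul1r !addr0.
move=> x y; have := two 1 x y; have := two 'i x y.
have cji : ('i : C)^* = - 'i by exact: conjCi.
have ii : ('i : C) * 'i = -1 by rewrite -expr2 sqrCi.
rewrite !(cjD, cjM) !cjK !diag cji cj1.
move: (k x x) (k x y) (k y x) (k y y) => a b c d e2 e1.
have : 2 * (c - b^*) = 0.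
  have -> : 2 * (c - b^*) = ((a + b * 1 + (1 * c + 1 * d * 1)) -
    (a + b^* * 1 + (1 * c^* + 1 * d * 1))) +
    'i * ((a + b * 'i + (- 'i * c + - 'i * d * 'i)) -
    (a + b^* * - 'i + ('i * c^* + 'i * d * - 'i))) +
    (1 + 'i * 'i) * (c - b - b^* + c^*).
    by ring.
  by rewrite e1 e2 ii; ring.
by move=> /eqP; rewrite mulf_eq0 pnatr_eq0/= subr_eq0 => /eqP.
Qed.

End Kernels.

Section Schur.
Local Open Scope sesquilinear_scope.

(** The spectral theorem: the weights are the eigenvalues of [A], and the rows
    of [P] form an orthonormal eigenbasis. *)
Lemma psd_decomposition (K : numClosedFieldType) n (A : 'M[K]_n) :
  (forall i j, A j i = Num.conj (A i j)) ->
  (forall c : 'I_n -> K, 0 <= \sum_i \sum_j Num.conj (c i) * A i j * c j) ->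
  exists (w : 'I_n -> K) (P : 'M[K]_n), (forall l, 0 <= w l) /\
    forall i j, A i j = \sum_l w l * (Num.conj (P l i) * P l j).
Proof.
move=> Aherm Apsd.
have Ah : A \is hermsymmx.
  by apply/is_hermitianmxP; rewrite expr0 scale1r; apply/matrixP => i j; rewrite !mxE.
have /hermitian_normalmx/orthomx_spectralP := Ah.
have U := spectral_unitarymx A; have Uu := spectral_unit A.
move: U Uu; set P := spectralmx A; set D := spectral_diag A => U Uu AE.
exists (D 0), P; split=> [l|i j].
  have -> : D 0 l = (P *m A *m (P ^t* )) l l.
    rewrite AE (invmx_unitary U) !mulmxA mulmxtVK// (unitarymxP U) mul1mx.
    by rewrite mxE eqxx mulr1n.
  have := Apsd (fun j => Num.conj (P l j)); congr (0 <= _).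
  rewrite exchange_big mxE; apply: eq_bigr => j _.
  rewrite !mxE mulr_suml; apply: eq_bigr => i _.
  by rewrite conjCK.
rewrite {1}AE (invmx_unitary U) mxE; apply: eq_bigr => l _.
rewrite mul_mx_diag !mxE; ring.
Qed.

(** The Schur product theorem.  After a decomposition of the first matrix into
    rank one pieces, the quadratic form of the product is a combination, with
    nonnegative weights, of values of the quadratic form of the second. *)
Theorem kernel_mul (R : realType) (X : Type) (k1 k2 : X -> X -> R[i]) :
  is_kernel k1 -> is_kernel k2 -> is_kernel (fun x y => k1 x y * k2 x y).
Proof.
move=> K1 K2 n x c.
have [||w [P [w0 AE]]] := @psd_decomposition _ n (\matrix_(i, j) k1 (x i) (x j)).
- by move=> i j; rewrite !mxE; exact: kernel_herm.
- by move=> e; under eq_bigr do under eq_bigr do rewrite mxE; exact: (K1 n x e).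
have -> : \sum_(i < n) \sum_(j < n)
      Num.conj (c i) * (k1 (x i) (x j) * k2 (x i) (x j)) * c j =
    \sum_l w l * \sum_(i < n) \sum_(j < n)
      Num.conj (P l i * c i) * k2 (x i) (x j) * (P l j * c j).
  under [RHS]eq_bigr do rewrite mulr_sumr.
  rewrite [RHS]exchange_big; apply: eq_bigr => i _.
  under [RHS]eq_bigr do rewrite mulr_sumr.
  rewrite [RHS]exchange_big; apply: eq_bigr => j _.
  have := AE i j; rewrite mxE => ->.
  rewrite mulr_suml mulr_sumr mulr_suml; apply: eq_bigr => l _.
  rewrite rmorphM; ring.
apply: sumr_ge0 => l _; apply: mulr_ge0 => //.
Qed.

End Schur.

(** * Multipliers of reproducing kernel Hilbert spaces *)

Section Multipliers.
Variables (R : realType) (X : Type) (k : X -> X -> R[i]) (H : rkhs k).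
Local Notation C := R[i].

Lemma total_sections : total_family (@rk_section _ _ _ H).
Proof.
move=> g g0; apply: (@rk_eval_inj _ _ _ H); apply/funext => x.
by rewrite -!rk_reproducing g0 inner0l.
Qed.

Lemma evalD (f g : H) x : rk_eval (f + g) x = rk_eval f x + rk_eval g x.
Proof. by rewrite -!rk_reproducing innerDl. Qed.

Lemma evalZ (a : C) (f : H) x : rk_eval (a *: f) x = a * rk_eval f x.
Proof. by rewrite -!rk_reproducing innerZl. Qed.

Lemma multiplier_cst (a : C) : multiplier H (fun=> a).
Proof. by move=> f; exists (a *: f) => x; rewrite evalZ. Qed.

Lemma multiplierD phi psi : multiplier H phi -> multiplier H psi ->
  multiplier H (fun x => phi x + psi x).
Proof.
move=> mphi mpsi f; have [g gE] := mphi f; have [h hE] := mpsi f.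
by exists (g + h) => x; rewrite evalD gE hE mulrDl.
Qed.

Lemma multiplierM phi psi : multiplier H phi -> multiplier H psi ->
  multiplier H (fun x => phi x * psi x).
Proof.
move=> mphi mpsi f; have [g gE] := mpsi f; have [h hE] := mphi g.
by exists h => x; rewrite hE gE mulrA.
Qed.

Lemma gram_sections x y : inner (rk_section H y) (rk_section H x) = k x y.
Proof. by rewrite rk_reproducing rk_sectionE. Qed.

(** Multipliers are bounded.  The adjoint images of the combinations of norm at
    most 1 are weakly bounded, because pairing [f] with such an image is
    pairing [phi f] with the combination; hence they are bounded. *)
Theorem multiplier_dual_bound (phi : X -> C) : multiplier H phi ->
  exists2 c : R, 0 <= c & dual_bound (@rk_section _ _ _ H) phi c.
Proof.
move=> mphi; pose v := @rk_section _ _ _ H.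
pose G := [set g : H | exists2 r, nrm (comb v r) <= 1 & g = comb v (twist phi r)].
have [|K GK] := @weakly_bounded _ _ G.
  move=> f; have [g gE] := mphi f; exists (nrm g) => _ [r r1 ->].
  have -> : inner f (comb v (twist phi r)) = inner g (comb v r).
    rewrite inner_twist inner_comb; apply: eq_bigr => p _.
    by rewrite !rk_reproducing gE.
  by rewrite (le_trans (cauchy_schwarz _ _))// ler_piMr ?nrm_ge0.
have K0 : 0 <= K.
  by apply: le_trans (nrm_ge0 _) (GK _ _); exists [::] => //; rewrite /comb big_nil nrm0.
exists K => // r.
have twist_scale t q : twist phi (scale_comb t q) = scale_comb t (twist phi q).
  by rewrite /twist /scale_comb -!map_comp; apply: eq_map => p /=; rewrite mulrA.
have scaled (t : R) : 0 <= t -> t * nrm (comb v r) <= 1 ->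
    t * nrm (comb v (twist phi r)) <= K.
  move=> t0 tr; have := GK (comb v (twist phi (scale_comb t%:C r))).
  rewrite twist_scale comb_scale nrmZ nrm_real ger0_norm//; apply.
  exists (scale_comb t%:C r); last by rewrite twist_scale comb_scale.
  by rewrite comb_scale nrmZ nrm_real ger0_norm.
(* A combination of norm 0 can be scaled arbitrarily, so its image has norm 0. *)
have := nrm_ge0 (comb v r); rewrite le_eqVlt => /predU1P[r0|r0].
  rewrite -r0 mulr0 leNgt; apply/negP => h.
  have := scaled ((K + 1) / nrm (comb v (twist phi r))).
  rewrite -r0 mulr0 divfK ?gt_eqF// => /(_ _ _)/wrap[||]//.
    by rewrite divr_ge0 ?addr_ge0 ?nrm_ge0.
  by rewrite leNgt ltrDl ltr01.
have := scaled (nrm (comb v r))^-1; rewrite mulVf ?gt_eqF// invr_ge0 nrm_ge0.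
by move=> /(_ isT (lexx _)); rewrite ler_pdivrMl// mulrC.
Qed.

End Multipliers.

(** * Multiplication on a Hilbert space tensor product *)

Section Dense.
Variables (R : realType) (H : hilbertType R).
Local Notation C := R[i].

Lemma dense_seq (S : set H) : dense S ->
  forall F : H, exists2 y : nat -> H, (forall n, S (y n)) & y @ \oo --> F.
Proof.
move=> dS F; have near n : exists y, S y /\ nrm (y - F) < n.+1%:R^-1.
  have e0 : 0 < (n.+1%:R^-1)%:C :> C by rewrite ltcR invr_gt0.
  have [||y [/= yF Sy]] := dS (ball F (n.+1%:R^-1)%:C).
  - by exists F; exact: ballxx.
  - exact: ball_open.
  exists y; split=> //; move: yF; rewrite -ball_normE /= -nrm_lt.
  by rewrite nrmC.
have [y yP] := choice near.
exists y => [n|]; first by case: (yP n).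
apply/cvg_nrmP => e /harmonic_small[N NP]; exists N => n /NP.
by apply: lt_trans; case: (yP n).
Qed.

Lemma bounded_linear_continuous (B : H -> H) (c : R) :
  linear B -> (forall F, nrm (B F) <= c * nrm F) -> continuous B.
Proof.
move=> linB Bc F; have BB G : B (F - G) = B F - B G.
  by rewrite addrC -scaleN1r linB scaleN1r addrC.
apply/cvgrPdist_lt => e e0.
have re0 := pos_cre e0.
have c1 : 0 < `|c| + 1 by rewrite ltr_wpDl.
apply/nbhs_normP; exists (cre e / (`|c| + 1))%:C => /=.
  by rewrite ltcR divr_gt0.
move=> G; rewrite /= -nrm_lt ltr_pdivlMr// (pos_real e0) -nrm_lt -BB => h.
apply: le_lt_trans (Bc _) _; apply: le_lt_trans h.
by rewrite mulrC ler_wpM2l ?nrm_ge0// (le_trans (ler_norm c))// lerDl.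
Qed.

End Dense.

Section Tensor.
Variables (R : realType) (X : Type) (k : X -> X -> R[i]) (H : rkhs k).
Variables (E : hilbertType R) (T : hilbert_tensor H E).
Local Notation C := R[i].
Local Notation sec := (@rk_section _ _ _ H).

Definition tensor_section (p : X * E) : T := tens T (sec p.1) p.2.

Lemma nrm_tens f e : nrm (tens T f e) = nrm f * nrm e.
Proof.
apply/eqP; rewrite -(@eqrXn2 _ 2) ?mulr_ge0 ?nrm_ge0// exprMn !nrm_sqr.
by rewrite inner_tens 2!inner_nrm -rmorphM.
Qed.

Lemma tens_comb r e :
  tens T (comb sec r) e = \sum_(p <- r) p.1 *: tens T (sec p.2) e.
Proof.
rewrite /comb; elim: r => [|p r IH]; first by rewrite !big_nil linear0l.
by rewrite !big_cons linearDl linearZl_LR IH.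
Qed.

(** The vectors [k_x ⊗ e] play the role of kernel functions for the tensor
    product.  Kernel functions are total in the first factor, so a vector
    orthogonal to all [k_x ⊗ e] is orthogonal to all [f ⊗ e], whose sums are
    dense. *)
Lemma total_tensor_sections : total_family tensor_section.
Proof.
move=> g g0.
have orth f e : inner (tens T f e) g = 0.
  apply/eqP; rewrite -nrm_eq0 eq_le nrm_ge0 andbT.
  apply/ler_addgt0Pr => d d0; rewrite add0r.
  have eg0 : 0 < nrm e * nrm g + 1 by rewrite ltr_wpDl ?mulr_ge0 ?nrm_ge0.
  have [|r rP] := total_dense (@total_sections _ _ _ H) f (e := d / (nrm e * nrm g + 1)).
    exact: divr_gt0.
  have -> : inner (tens T f e) g = inner (tens T (f - comb sec r) e) g.
    rewrite linearBl innerBl tens_comb inner_suml big1 ?subr0// => p _.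
    rewrite innerZl -inner_conj; have := g0 (p.2, e).
    by rewrite /tensor_section /= => ->; rewrite rmorph0 mulr0.
  apply: le_trans (cauchy_schwarz _ _) _; rewrite nrm_tens -mulrA.
  move: rP; rewrite ltr_pdivlMr// => /ltW; apply: le_trans.
  by rewrite ler_wpM2l ?nrm_ge0// lerDl.
have [y yS yg] := dense_seq (@dense_tens _ _ _ T) g.
apply/eqP; rewrite -nrm_eq0 -sqrf_eq0 nrm_sqr.
suff -> : inner g g = 0 by [].
apply: cvg_nrm_unique (cvg_inner yg) _.
have y0 n : inner (y n) g = 0.
  by have [r _ <-] := yS n; rewrite inner_suml big1.
by under eq_fun do rewrite y0; exact: cvg_cst.
Qed.

(** Both sides are continuous in [F], and they agree on sums of elementary
    tensors. *)
Lemma tensor_mult_inner (phi : X -> C) (A : H -> H) (B : T -> T) :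
  is_mult_op phi A -> is_tensor_id A B ->
  forall F p, inner (B F) (tensor_section p) = phi p.1 * inner F (tensor_section p).
Proof.
move=> Aphi [linB contB BA] F p.
have B0 : B 0 = 0.
  by have := linB (-1) 0 0; rewrite scaleN1r oppr0 addr0 scaleN1r addNr.
have [y yS yF] := dense_seq (@dense_tens _ _ _ T) F.
have yB n : inner (B (y n)) (tensor_section p) = phi p.1 * inner (y n) (tensor_section p).
  have [r _ <-] := yS n; elim: r => [|q r IH].
    by rewrite big_nil B0 inner0l mulr0.
  rewrite big_cons -[tens _ _ _]scale1r linB scale1r !innerDl IH BA mulrDr.
  by rewrite scale1r !inner_tens !rk_reproducing Aphi mulrA.
have l1 : (fun n => inner (B (y n)) (tensor_section p)) @ \oo -->
    inner (B F) (tensor_section p).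
  apply: cvg_inner; apply: cvg_comp yF _; exact: contB.
apply: cvg_nrm_unique l1 _; under eq_fun do rewrite yB.
by apply: cvgMl_tmp; exact: cvg_inner.
Qed.

Lemma dual_bound_tensor_op (phi : X -> C) (c : R) : 0 <= c ->
  dual_bound sec phi c -> dual_bound tensor_section (fun p => phi p.1) c ->
  exists (A : H -> H) (B : T -> T), [/\ is_mult_op phi A, is_tensor_id A B &
    forall F, nrm (B F) <= c * nrm F].
Proof.
move=> c0 bH bT.
have [A AP] := choice (dual_bound_op c0 bH).
have [B BP] := choice (dual_bound_op c0 bT).
have Aphi : is_mult_op phi A.
  by move=> f x; rewrite -!rk_reproducing; case: (AP f).
have Bphi F p : inner (B F) (tensor_section p) = phi p.1 * inner F (tensor_section p).
  by case: (BP F).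
have Bc F : nrm (B F) <= c * nrm F by case: (BP F).
have linB : linear B.
  move=> a F G; apply: (inner_ext total_tensor_sections) => p.
  by rewrite Bphi !innerDl !innerZl !Bphi mulrDr mulrCA.
exists A, B; split=> //; split=> //; first exact: bounded_linear_continuous Bc.
move=> f e; apply: (inner_ext total_tensor_sections) => p.
by rewrite Bphi !inner_tens !rk_reproducing Aphi mulrA.
Qed.

End Tensor.

Section Transfer.
Variables (R : realType) (X : Type) (k s : X -> X -> R[i]).
Variables (Hk : rkhs k) (Hs : rkhs s) (E : hilbertType R).
Variable (T : hilbert_tensor Hk E).
Hypothesis s_neq0 : forall x y, s x y != 0.
Hypothesis ks : is_kernel (fun x y => k x y / s x y).
Local Notation C := R[i].

(** Multipliers of [Hs] are multipliers of [Hk], with the same bound: the kernel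
    [(c^2 - phi(x) conj(phi(y))) k(x,y)] is the product of
    [(c^2 - phi(x) conj(phi(y))) s(x,y)] and [k(x,y) / s(x,y)]. *)
Lemma dual_bound_quotient (phi : X -> C) (c : R) : 0 <= c ->
  dual_bound (@rk_section _ _ _ Hs) phi c ->
  dual_bound (@rk_section _ _ _ Hk) phi c.
Proof.
move=> c0 /(dual_bound_kernel _ _ c0) b; apply/(dual_bound_kernel _ _ c0).
apply: kernel_ext (kernel_mul b ks) => x y /=.
by rewrite !gram_sections; field.
Qed.

(** The tensor factor [E] multiplies the kernel by the Gram kernel of [E]. *)
Lemma dual_bound_tensor (phi : X -> C) (c : R) : 0 <= c ->
  dual_bound (@rk_section _ _ _ Hk) phi c ->
  dual_bound (tensor_section T) (fun p => phi p.1) c.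
Proof.
move=> c0 /(dual_bound_kernel _ _ c0) b; apply/(dual_bound_kernel _ _ c0).
have := kernel_mul (kernel_comp (fst : X * E -> X) b)
  (gram_kernel (snd : X * E -> E)).
by apply: kernel_ext => p q; rewrite inner_tens mulrA.
Qed.

End Transfer.

(** * Geometrically dominated series in one variable *)

Section Series.
Variable R : realType.
Local Notation C := R[i].
Implicit Types (g x : nat -> C) (K : R).

Lemma geometric_tail g x K (e : R) a b :
  (forall m, nrm (g m) <= K / 2 ^+ m) -> 0 <= e ->
  (forall m, (a <= m)%N -> nrm (x m) <= e) ->
  nrm (\sum_(a <= m < b) g m * x m) <= e * (2 * K / 2 ^+ a).
Proof.
move=> gK e0 xe.
have K0 : 0 <= K by have := le_trans (nrm_ge0 _) (gK 0%N); rewrite expr0 divr1.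
have [ab|ba] := leqP a b; last first.
  by rewrite big_geq ?nrm0 ?(ltnW ba)// mulr_ge0// divr_ge0 ?mulr_ge0 ?exprn_ge0.
apply: le_trans (nrm_sum _ _ _) _.
apply: (@le_trans _ _ (e * (2 * K / 2 ^+ a - 2 * K / 2 ^+ b))); last first.
  by rewrite ler_wpM2l// gerBl divr_ge0 ?mulr_ge0 ?exprn_ge0.
elim: b ab => [|b IH]; first by rewrite leqn0 => /eqP ->; rewrite big_nil subrr mulr0.
rewrite leq_eqVlt ltnS => /predU1P[<-|ab]; first by rewrite big_geq// subrr mulr0.
rewrite big_nat_recr//= nrmM; have := IH ab => {}IH.
have h : nrm (g b) * nrm (x b) <= (K / 2 ^+ b) * e.
  by apply: ler_pM; rewrite ?nrm_ge0// xe.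
have -> : 2 * K / 2 ^+ b.+1 = 2 * K / 2 ^+ b - K / 2 ^+ b.
  by rewrite exprS invfM; move: (2 ^- b) => y; field.
apply: le_trans (lerD IH h) _.
by move: (2 * K / 2 ^+ b) (K / 2 ^+ b) (2 * K / 2 ^+ a) => x1 x2 x3; lra.
Qed.

Lemma cvg_bounded (V : normedModType C) (u : nat -> V) (l : V) :
  u @ \oo --> l -> exists K : R, forall n, nrm (u n) <= K.
Proof.
move=> /cvg_nrmP/(_ 1 ltr01)[N NP].
pose S := \sum_(i < N) nrm (u i).
have S0 : 0 <= S by apply: sumr_ge0 => i _; exact: nrm_ge0.
exists (S + nrm l + 1) => n; have [nN|Nn] := ltnP n N.
  apply: (@le_trans _ _ S); last by rewrite -addrA lerDl addr_ge0 ?nrm_ge0.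
  rewrite /S (bigD1 (Ordinal nN))//= lerDl.
  by apply: sumr_ge0 => i _; exact: nrm_ge0.
have := NP n Nn; have := nrmD (u n - l) l; rewrite subrK; lra.
Qed.

Lemma series_terms_bounded (u : nat -> C) (l : C) :
  (fun n => \sum_(0 <= m < n) u m) @ \oo --> l ->
  exists K : R, forall m, nrm (u m) <= K.
Proof.
move=> /cvg_bounded[K KP]; exists (K + K) => m.
have -> : u m = \sum_(0 <= i < m.+1) u i - \sum_(0 <= i < m) u i.
  by rewrite big_nat_recr//= addrAC subrr add0r.
by apply: le_trans (nrmB _ _) _; rewrite lerD.
Qed.

(** A power series that is constant for small negative arguments is constant.
    If the coefficients of positive index below [m] vanish, the one of index
    [m] is bounded by a multiple of [t], for all small [t].  Values on one side
    of 0 suffice, which lets [analytic_segment] advance along a segment without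
    re-expanding a power series around another centre. *)
Lemma series_const_left g K (l : C) :
  (forall m, nrm (g m) <= K / 2 ^+ m) ->
  (forall t : R, 0 < t <= 1 ->
    (fun n => \sum_(0 <= m < n) g m * (- t%:C) ^+ m) @ \oo --> l) ->
  forall m, g m = if m is 0 then l else 0.
Proof.
move=> gK gl; pose h m := g m - if m is 0 then l else 0.
have K0 : 0 <= K by have := le_trans (nrm_ge0 _) (gK 0%N); rewrite expr0 divr1.
suff h0 m : h m = 0 by move=> m; apply/eqP; rewrite -subr_eq0; apply/eqP/h0.
elim/ltn_ind: m => m IH.
have small (t : R) : 0 < t <= 1 -> nrm (h m) <= t * (2 * K).
  move=> t01; have /andP[t0 t1] := t01.
  have tn : nrm (- t%:C : C) = t by rewrite nrmN nrm_real gtr0_norm.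
  have split n : (m < n)%N -> \sum_(0 <= i < n) g i * (- t%:C) ^+ i - l =
      h m * (- t%:C) ^+ m + \sum_(m.+1 <= i < n) g i * (- t%:C) ^+ i.
    move=> mn; rewrite (big_cat_nat _ (n := m.+1))//= addrAC; congr (_ + _).
    have -> : l = \sum_(0 <= i < m.+1) (if i is 0 then l else 0) * (- t%:C) ^+ i.
      by rewrite big_nat_recl// expr0 mulr1 big1 ?addr0// => i _; rewrite mul0r.
    rewrite -sumrB big_nat_recr//= big_nat_cond big1 ?add0r -?mulrBl// => i.
    by rewrite andbT => /andP[_ im]; rewrite -mulrBl -/(h i) IH// mul0r.
  have : nrm (h m * (- t%:C) ^+ m) <= t ^+ m.+1 * (2 * K).
    apply/ler_addgt0Pr => e e0.
    have /cvg_nrmP/(_ e e0)[N NP] := gl t t01.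
    pose n := maxn N m.+1.
    have := NP n (leq_maxl _ _); rewrite split ?leq_maxr// => h1.
    have h2 : nrm (\sum_(m.+1 <= i < n) g i * (- t%:C) ^+ i) <=
        t ^+ m.+1 * (2 * K / 2 ^+ m.+1).
      apply: geometric_tail gK _ _ => [|i mi]; first by rewrite exprn_ge0// ltW.
      by rewrite nrmX tn ler_wiXn2l// ltW.
    have h3 : t ^+ m.+1 * (2 * K / 2 ^+ m.+1) <= t ^+ m.+1 * (2 * K).
      rewrite ler_wpM2l ?exprn_ge0 ?(ltW t0)//.
      by rewrite ler_pdivrMr ?exprn_gt0// ler_peMr ?mulr_ge0// exprn_ege1// ler1n.
    have := nrmB (h m * (- t%:C) ^+ m + \sum_(m.+1 <= i < n) g i * (- t%:C) ^+ i)
     (\sum_(m.+1 <= i < n) g i * (- t%:C) ^+ i).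
    rewrite addrK; lra.
  by rewrite nrmM nrmX tn exprS mulrC -mulrA mulrCA ler_pM2l// exprn_gt0.
apply/eqP; rewrite -nrm_eq0 eq_le nrm_ge0 andbT.
apply/ler_addgt0Pr => e e0; rewrite add0r.
have K1 : 0 < 2 * K + 1 by rewrite ltr_wpDl ?mulr_ge0.
pose t := Num.min 1 (e / (2 * K + 1)).
have t0 : 0 < t by rewrite lt_min ltr01 divr_gt0.
have := small t; rewrite t0 ge_min lexx => /(_ isT)/le_trans; apply.
have : t <= e / (2 * K + 1) by rewrite ge_min lexx orbT.
rewrite ler_pdivlMr//; apply: le_trans.
by rewrite ler_wpM2l ?(ltW t0)// lerDl.
Qed.

End Series.

(** * Homogeneous expansions of power series *)

Section Homogeneous.
Variables (R : realType) (d : nat).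
Local Notation C := R[i].
Local Notation V := 'rV[C]_d.
Implicit Types (al : {ffun 'I_d -> nat}) (v : V) (m : nat).

Definition mdeg al := (\sum_i al i)%N.

Definition hom_exps m : seq {ffun 'I_d -> nat} :=
  [seq [ffun i => val (b i)] | b : {ffun 'I_d -> 'I_m.+1} <- enum predT
    & (\sum_i b i == m)%N].

Lemma mem_hom_exps m al : (al \in hom_exps m) = (mdeg al == m).
Proof.
apply/mapP/eqP => [[b]|am].
  rewrite mem_filter => /andP[/eqP bm _] ->; rewrite -[RHS]bm.
  by apply: eq_bigr => i _; rewrite ffunE.
have alm i : (al i < m.+1)%N by rewrite ltnS -am /mdeg (bigD1 i)//= leq_addr.
exists [ffun i => Ordinal (alm i)].
  rewrite mem_filter mem_enum andbT; apply/eqP.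
  by rewrite -[RHS]am; apply: eq_bigr => i _; rewrite ffunE.
by apply/ffunP => i; rewrite !ffunE.
Qed.

Lemma hom_exps_uniq m : uniq (hom_exps m).
Proof.
rewrite map_inj_uniq; first exact/filter_uniq/enum_uniq.
move=> b b' /ffunP bb'.
by apply/ffunP => i; apply/val_inj; have := bb' i; rewrite !ffunE.
Qed.

Definition hom_part (c : {ffun 'I_d -> nat} -> C) m v :=
  \sum_(al <- hom_exps m) c al * monomial al v.

Lemma monomialZ (t : C) al v :
  monomial al (t *: v) = t ^+ mdeg al * monomial al v.
Proof.
rewrite /monomial /mdeg -prodrXr -big_split /=.
by apply: eq_bigr => i _; rewrite mxE exprMn.
Qed.

(** Along a line through the centre the power series in several variables is a
    power series in one, whose coefficients are the homogeneous parts. *)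
Lemma hom_partZ c m (t : C) v : hom_part c m (t *: v) = t ^+ m * hom_part c m v.
Proof.
rewrite /hom_part mulr_sumr big_seq [RHS]big_seq.
apply: eq_bigr => al; rewrite mem_hom_exps => /eqP <-.
by rewrite monomialZ mulrCA.
Qed.

Definition low_exps n := [fset al in flatten [seq hom_exps m | m <- index_iota 0 n]]%fset.

Lemma mem_low_exps n al : (al \in low_exps n) = (mdeg al < n)%N.
Proof.
rewrite inE; apply/flatten_mapP/idP => [[m]|aln].
  by rewrite mem_index_iota mem_hom_exps => mn /eqP ->.
by exists (mdeg al); rewrite ?mem_index_iota ?mem_hom_exps.
Qed.

Lemma partial_sum_low_exps (x : {ffun 'I_d -> nat} -> C) n :
  partial_sum x (low_exps n) =
  \sum_(0 <= m < n) \sum_(al <- hom_exps m) x al.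
Proof.
rewrite /partial_sum -(big_seq_fsetE _ (low_exps n) xpredT x).
transitivity (\sum_(al <- flatten [seq hom_exps m | m <- index_iota 0 n]) x al).
  apply/perm_big/uniq_perm; first exact: fset_uniq.
    elim: n => [//|n IH]; rewrite -addn1 /index_iota !subn0 iotaD map_cat flatten_cat.
    move: IH; rewrite /index_iota subn0 => IH.
    rewrite cat_uniq IH/= cats0 hom_exps_uniq andbT -all_predC.
    apply/allP => al; rewrite mem_hom_exps => /eqP am /=.
    apply/flatten_mapP => -[m]; rewrite mem_iota mem_hom_exps am add0n => mn /eqP e.
    by rewrite e ltnn in mn.
  by move=> al; rewrite inE.
by rewrite big_flatten big_map.
Qed.

(** Truncations by total degree are cofinal among finite sets of exponents, so
    an unconditional sum is also the limit of the sums of homogeneous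
    parts. *)
Lemma cvg_low_exps : low_exps n @[n --> \oo] --> totally.
Proof.
move=> B [A _ AB]; exists (\max_(al <- A) mdeg al).+1 => // n /= An.
apply: AB; apply/fsubsetP => al alA; rewrite mem_low_exps.
by apply: leq_trans An; rewrite ltnS; exact: leq_bigmax_seq.
Qed.

Definition polydisc (rho : R) v := forall i, nrm (v 0 i) < rho.

Lemma polydisc_small (rho : R) v : 0 < rho ->
  exists2 e : R, 0 < e & forall t : C, nrm t <= e -> polydisc rho (t *: v).
Proof.
move=> rho0; pose S := \sum_i nrm (v 0 i).
have S0 : 0 <= S by apply: sumr_ge0 => i _; exact: nrm_ge0.
have S1 : 0 < S + 1 by rewrite ltr_wpDl.
exists (rho / (S + 1)); first exact: divr_gt0.
move=> t te i; rewrite mxE nrmM.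
have vS : nrm (v 0 i) <= S.
  by rewrite /S (bigD1 i)//= lerDl sumr_ge0// => j _; exact: nrm_ge0.
apply: (@le_lt_trans _ _ (rho / (S + 1) * S)).
  by rewrite ler_pM ?nrm_ge0.
by rewrite mulrAC ltr_pdivrMr// ltr_pM2l// ltrDl.
Qed.

Lemma polydiscD (r1 r2 : R) v w : polydisc r1 v -> polydisc r2 w ->
  polydisc (r1 + r2) (v + w).
Proof.
move=> vr wr i; rewrite mxE; apply: le_lt_trans (nrmD _ _) _; exact: ltrD.
Qed.

Lemma nbhs_polydisc (x : V) (A : set V) :
  nbhs x A <-> exists2 e : R, 0 < e & forall v, polydisc e v -> A (x + v).
Proof.
split=> [/nbhs_ballP[e e0 eA]|[e e0 eA]].
  exists (cre e); first exact: pos_cre.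
  move=> v ve; apply: eA; split=> // i j.
  rewrite ord1 -ball_normE /= mxE opprD addNKr normrN (pos_real e0) -nrm_lt.
  exact: ve.
apply/nbhs_ballP; exists e%:C; first by rewrite /= ltcR.
move=> y [_ xy]; rewrite -(subrKC x y); apply: eA => i.
have := xy 0 i; rewrite -ball_normE /= -nrm_lt nrmC !mxE.
by [].
Qed.

End Homogeneous.

(** * Analytic functions and the identity theorem *)

Section Expansion.
Variables (R : realType) (d : nat) (Omega : set 'rV[R[i]]_d).
Local Notation C := R[i].
Local Notation V := 'rV[C]_d.
Hypothesis oOmega : open Omega.
Implicit Types (f : Omega -> C).

Lemma point_of (x : V) : Omega x -> exists z : Omega, val z = x.
Proof. by move=> Ox; exists (SigSub (mem_set Ox)). Qed.

Lemma point_in (z : Omega) : Omega (val z).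
Proof. exact: set_mem (valP z). Qed.

Lemma open_polydisc (x : V) : Omega x ->
  exists2 e : R, 0 < e & forall v, polydisc e v -> Omega (x + v).
Proof. by move=> Ox; apply/nbhs_polydisc; exact: open_nbhs_nbhs. Qed.

(** The geometric bound holds on half of the polydisc of convergence: at [2 v]
    the series of the [2^m hom_part c m v] still converges, hence has bounded
    terms. *)
Theorem analytic_expansion f (a : Omega) : analytic f ->
  exists (c : {ffun 'I_d -> nat} -> C) (rho : R), [/\ 0 < rho,
    forall v, polydisc rho v -> Omega (val a + v),
    forall v, polydisc rho v ->
      exists K : R, forall m, nrm (hom_part c m v) <= K / 2 ^+ m &
    forall v (z : Omega), polydisc rho v -> val z = val a + v ->
      (fun n => \sum_(0 <= m < n) hom_part c m v) @ \oo --> f z].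
Proof.
move=> /(_ a)[c [r r0 cf]].
have [e e0 eO] := open_polydisc (point_in a).
pose rho := Num.min e (cre r).
have rho0 : 0 < rho by rewrite lt_min e0 pos_cre.
have disc v : polydisc rho v -> Omega (val a + v).
  by move=> vr; apply: eO => i; apply: lt_le_trans (vr i) _; rewrite ge_min lexx.
have conv v (z : Omega) : polydisc rho v -> val z = val a + v ->
    (fun n => \sum_(0 <= m < n) hom_part c m v) @ \oo --> f z.
  move=> vr za; have zav : val z - val a = v by rewrite za addrAC subrr add0r.
  have := cf z; rewrite zav => /(_ _)/wrap[|cfz].
    move=> i; rewrite /coordinate (pos_real r0) -nrm_lt za mxE addrAC subrr add0r.
    by apply: lt_le_trans (vr i) _; rewrite ge_min lexx orbT.
  have := cvg_comp _ _ (@cvg_low_exps d) cfz.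
  rewrite (_ : _ \o _ = fun n => \sum_(0 <= m < n) hom_part c m v)//.
  by apply/funext => n /=; rewrite partial_sum_low_exps.
exists c, (rho / 2); split.
- by rewrite divr_gt0.
- move=> v vr; apply: disc => i; apply: lt_le_trans (vr i) _.
  by rewrite ler_pdivrMr// ler_peMr ?ler1n// ltW.
- move=> v vr; have v2 : polydisc rho (2%:R *: v).
    by move=> i; rewrite mxE nrmM nrm_nat mulrC -ltr_pdivlMr//; exact: vr.
  have [z za] := point_of (disc _ v2).
  have [K KP] := series_terms_bounded (conv _ _ v2 za).
  exists K => m; rewrite ler_pdivlMr ?exprn_gt0//; have := KP m.
  by rewrite hom_partZ nrmM nrmX nrm_nat mulrC.
- move=> v z vr; apply: conv => i; apply: lt_le_trans (vr i) _.
  by rewrite ler_pdivrMr// ler_peMr ?ler1n// ltW.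
Qed.

(** Let [tau] be the supremum of the times up to which [f] equals [l] on the
    segment.  The expansion of [f] around the point at time [tau], restricted
    to the segment, equals [l] before [tau], hence also after [tau] by
    [series_const_left]. *)
Lemma analytic_segment f (l : C) (b : V) (v : V) : analytic f ->
  (forall t : R, 0 <= t <= 1 -> Omega (b + t%:C *: v)) ->
  (exists2 e : R, 0 < e & forall z : Omega, polydisc e (val z - b) -> f z = l) ->
  forall z : Omega, val z = b + v -> f z = l.
Proof.
move=> af seg [e e0 near_b].
pose P (t : R) := forall z : Omega, val z = b + t%:C *: v -> f z = l.
pose T := [set t : R | 0 <= t <= 1 /\ forall s : R, 0 <= s <= t -> P s].
have [h h0 small] := polydisc_small v e0.
have Th : T (Num.min 1 h).
  split=> [|s /andP[s0 sh] z zs].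
    by rewrite ge_min lexx le_min ler01 ltW.
  apply: near_b; rewrite zs addrAC subrr add0r; apply: small.
  by rewrite nrm_real ger0_norm// (le_trans sh)// ge_min lexx orbT.
have Tsup : has_sup T by split; [exists (Num.min 1 h) | exists 1 => t [/andP[]]].
pose tau := sup T.
have tau0 : 0 < tau.
  apply: lt_le_trans (ub_le_sup (proj2 Tsup) Th).
  by rewrite lt_min ltr01.
have tau1 : tau <= 1 by apply: ge_sup => [|t [/andP[]]]; case: Tsup.
have below s : 0 <= s -> s < tau -> P s.
  move=> s0 st; have [|t [_ tP] ts] := @sup_adherent _ T (tau - s) _ Tsup.
    by rewrite subr_gt0.
  by apply: tP; rewrite s0 ltW//; move: ts; rewrite -/tau opprB addrC subrK.
have [a aE] := point_of (seg tau (introT andP (conj (ltW tau0) tau1))).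
have [c [rho [rho0 disc geo conv]]] := analytic_expansion a af.
have [h' h'0 small'] := polydisc_small v rho0.
(* [k] is at most [tau], so that the steps [- t * k] with [t <= 1] do not leave
   the segment, and small enough for the expansion around [a]. *)
pose k := Num.min tau h'.
have k0 : 0 < k by rewrite lt_min tau0.
have ktau : k <= tau by rewrite ge_min lexx.
have kh' : k <= h' by rewrite ge_min lexx orbT.
have kv (t : R) : `|t| <= 1 -> polydisc rho (t%:C *: (k%:C *: v)).
  move=> t1; rewrite scalerA -rmorphM; apply: small'.
  by rewrite nrm_real normrM (gtr0_norm k0) (le_trans _ kh')// ler_piMl// ltW.
have [K KP] : exists K : R, forall m, nrm (hom_part c m (k%:C *: v)) <= K / 2 ^+ m.
  by apply: geo; have := kv 1; rewrite normr1 scale1r; exact.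
have pt (t : R) : val a + t%:C *: (k%:C *: v) = b + (tau + t * k)%:C *: v.
  by rewrite aE scalerA -rmorphM -addrA -scalerDl -rmorphD.
have coef : forall m, hom_part c m (k%:C *: v) = if m is 0 then l else 0.
  apply: series_const_left KP _ => t /andP[t0 t1].
  have tn : `|- t| <= 1 by rewrite normrN gtr0_norm.
  have [z zE] := point_of (disc _ (kv _ tn)).
  have <- : f z = l.
    apply: (below (tau + - t * k)); last by rewrite zE pt.
      rewrite mulNr subr_ge0 (le_trans _ ktau)// ler_piMl// ltW//.
    by rewrite mulNr gtrBl mulr_gt0.
  under eq_fun do under eq_bigr do rewrite mulrC -rmorphN -hom_partZ.
  exact: conv (kv _ tn) zE.
have above (t : R) : 0 <= t <= 1 -> P (tau + t * k).
  move=> /andP[t0 t1] z; rewrite -pt => zE.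
  have tn : `|t| <= 1 by rewrite ger0_norm.
  apply: (cvg_nrm_unique (conv _ _ (kv _ tn) zE)).
  apply/cvg_nrmP => e' e'0; exists 1%N => n n1.
  rewrite -(subnK n1) addn1 big_nat_recl// big1 ?addr0.
    by rewrite hom_partZ expr0 mul1r coef subrr nrm0.
  by move=> i _; rewrite hom_partZ coef mulr0.
have Tk : T (Num.min 1 (tau + k)).
  split=> [|s /andP[s0 sk]].
    by rewrite ge_min lexx le_min ler01 (ltW (addr_gt0 tau0 k0)).
  have [st|ts] := ltP s tau; first exact: below.
  have -> : s = tau + (s - tau) / k * k by rewrite divfK ?gt_eqF// subrKC.
  apply: above; rewrite divr_ge0 ?subr_ge0 ?(ltW k0)//= ler_pdivrMr// mul1r.
  by rewrite lerBlDl (le_trans sk)// ge_min lexx orbT.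
have tau_eq1 : tau = 1.
  apply/eqP; rewrite eq_le tau1 /=.
  have := ub_le_sup (proj2 Tsup) Tk; rewrite -/tau ge_min => /orP[//|].
  by rewrite gerDl leNgt k0.
move=> z zE; have := above 0; rewrite lexx ler01 mul0r addr0 tau_eq1 => /(_ isT z).
by rewrite scale1r; exact.
Qed.

(** The set of points near which [f] equals [l] is open; it is closed in
    [Omega] because, in a polydisc around a limit point, every point is joined
    by a segment to a point of the set. *)
Theorem identity_theorem f (l : C) (b : Omega) : connected Omega -> analytic f ->
  (exists2 e : R, 0 < e &
    forall z : Omega, polydisc e (val z - val b) -> f z = l) ->
  forall z : Omega, f z = l.
Proof.
move=> cO af nb.
pose Z := [set x | Omega x /\ exists2 e : R, 0 < e &
  forall z : Omega, polydisc e (val z - x) -> f z = l].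
suff ZE : Z = Omega.
  move=> z; have : Z (val z) by rewrite ZE; exact: point_in.
  move=> [_ [e e0]]; apply=> i.
  by rewrite subrr mxE nrm0.
apply: cO.
- by exists (val b); split=> //; exact: point_in.
- exists Z; last by rewrite setIidr// => x [].
  rewrite openE => x [Ox [e e0 xe]]; have [r r0 rO] := open_polydisc Ox.
  apply/nbhs_polydisc; exists (Num.min r (e / 2)).
    by rewrite lt_min r0 divr_gt0.
  move=> v vr; split.
    by apply: rO => i; apply: lt_le_trans (vr i) _; rewrite ge_min lexx.
  exists (e / 2); first by rewrite divr_gt0.
  move=> z zv; apply: xe; rewrite -(subrKA (x + v)) [e]splitr.
  apply: polydiscD => // i; rewrite addrAC subrr add0r.
  by apply: lt_le_trans (vr i) _; rewrite ge_min lexx orbT.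
- exists (closure Z); first exact: closed_closure.
  apply/seteqP; split=> [x Zx|x [Ox clx]].
    by split; [case: Zx | exact: subset_closure].
  have [r r0 rO] := open_polydisc Ox; split=> //; exists r => // z zx.
  have [|y [[Oy yl] ry]] := clx [set y | polydisc r (y - x)].
    by apply/nbhs_polydisc; exists r => // v; rewrite /= addrAC subrr add0r.
  (* The segment stays in the polydisc around [x], which is convex. *)
  apply: (analytic_segment (b := y) (v := val z - y) af) yl _ _ => [t /andP[t0 t1]|].
    have -> : y + t%:C *: (val z - y) = x + ((1 - t)%:C *: (y - x) + t%:C *: (val z - x)).
      apply/rowP => i; rewrite !mxE rmorphB rmorph1; ring.
    apply: rO => i; rewrite mxE; apply: le_lt_trans (nrmD _ _) _.
    rewrite !(mxE _ _ 0 i) !nrmM !nrm_real !ger0_norm ?subr_ge0//.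
    have := ry i; have := zx i; rewrite !mxE; move: (nrm _) (nrm _) => A B Ar Br.
    rewrite -subr_gt0 in Ar; rewrite -subr_gt0 in Br.
    have [t12|t12] := leP t (1 / 2).
      have t1' : 0 < 1 - t by lra.
      by have := mulr_gt0 t1' Br; have := mulr_ge0 t0 (ltW Ar); nra.
    have t0' : 0 < t by lra.
    have t1' : 0 <= 1 - t by lra.
    by have := mulr_gt0 t0' Ar; have := mulr_ge0 t1' (ltW Br); nra.
  by rewrite addrC subrK.
Qed.

End Expansion.

(** * Fejer weights on roots of unity *)

Section Fejer.
Variable R : realType.
Local Notation C := R[i].

Lemma dyadic_root l : exists w : C, (2 ^ l.+1).-primitive_root w.
Proof.
(* [w] has order dividing [2 ^ l.+1], but [w ^+ (2 ^ l) = -1]. *)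
pose w : C := (2 ^ l).-root (-1).
have wl : w ^+ (2 ^ l) = -1 by rewrite /w rootCK ?expn_gt0.
have [|k wk] := @prim_order_exists _ (2 ^ l.+1) w (expn_gt0 _ _).
  by rewrite expnS mulnC exprM wl sqrrN expr1n.
move=> /(dvdn_pfactor _ _ (isT : prime 2))[i il ki]; exists w.
have [li|] := leqP l.+1 i.
  by rewrite (_ : l.+1 = i) -?ki//; apply/eqP; rewrite eqn_leq li il.
rewrite ltnS => /(dvdn_exp2l 2); rewrite -ki => /dvdnP[q lq].
have : w ^+ (2 ^ l) = 1 by rewrite lq mulnC exprM (prim_expr_order wk) expr1n.
rewrite wl => /eqP; rewrite eq_sym -subr_eq0 opprK -(natrD _ 1 1) pnatr_eq0.
by [].
Qed.

(** With [w_j = |sum_(i < n) om^(j i)|^2 / (n N)], for [om] a primitive [N]-th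
    root of unity, the weights are values of the Fejer kernel, nonnegative by
    construction.  Expanding the square, the [m]-th moment counts the pairs
    [i, i' < n] with [i + m = i'] modulo [N]; when [m + n <= N] this is an
    equality of integers, with [n - m] solutions (truncated subtraction). *)
Lemma fejer_weights n l : (0 < n)%N ->
  exists (lam : 'I_(2 ^ l.+1) -> C) (w : 'I_(2 ^ l.+1) -> R),
    [/\ forall j, nrm (lam j) = 1, forall j, 0 <= w j &
    forall m, (m + n <= 2 ^ l.+1)%N ->
      \sum_j (w j)%:C * lam j ^+ m = ((n - m)%:R / n%:R : R)%:C].
Proof.
move=> n0; have [om pr] := dyadic_root l; set N := (2 ^ l.+1)%N in pr *.
have N0 : (0 < N)%N by rewrite expn_gt0.
have nom : nrm om = 1.
  have := congr1 (@nrm _ _) (prim_expr_order pr); rewrite nrmX nrm1 => /eqP.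
  by rewrite pexpr_eq1 ?nrm_ge0// => /eqP.
have cjom a : (om ^+ a)^* * om ^+ a = 1.
  by rewrite mulrC -sqr_nrm nrmX nom !expr1n.
have om0 a : om ^+ a != 0 by rewrite -nrm_eq0 nrmX nom expr1n oner_eq0.
have orth a b : (a < N)%N -> (b < N)%N ->
    \sum_(j < N) (om ^+ a * (om ^+ b)^*) ^+ j = (N * (a == b))%:R.
  move=> aN bN; have [<-|ab] := eqVneq a b.
    rewrite mulrC cjom; under eq_bigr do rewrite expr1n.
    by rewrite sumr_const card_ord muln1.
  rewrite muln0; set z := _ * _.
  have z1 : z != 1.
    apply: contra ab => /eqP/(congr1 ( *%R^~ (om ^+ b))).
    rewrite /z -mulrA cjom mulr1 mul1r => /eqP; rewrite (eq_prim_root_expr pr).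
    by rewrite !modn_small.
  have zN : z ^+ N = 1.
    have -> : z ^+ N = (om ^+ a * (om ^+ b)^*) ^+ N by [].
    rewrite exprMn -!exprM mulnC exprM (prim_expr_order pr) expr1n mul1r.
    by rewrite -cjX -exprM mulnC exprM (prim_expr_order pr) expr1n rmorph1.
  have := subrX1 z N; rewrite zN subrr => /esym/eqP; rewrite mulf_eq0 subr_eq0.
  by rewrite (negbTE z1) => /eqP.
pose S j := \sum_(i < n) (om ^+ j) ^+ i.
exists (fun j => om ^+ j), (fun j => nrm (S j) ^+ 2 / (n%:R * N%:R)); split=> [j|j|m mn].
- by rewrite nrmX nom expr1n.
- by rewrite divr_ge0 ?sqr_ge0 ?mulr_ge0.
have Nn0 : (n%:R * N%:R : C) != 0 by rewrite mulf_neq0 ?pnatr_eq0 -?lt0n.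
have inv : ((n%:R * N%:R)^-1 : R)%:C = (n%:R * N%:R)^-1.
  by rewrite fmorphV -!natrM rmorph_nat.
have term (j : 'I_N) : (nrm (S j) ^+ 2 / (n%:R * N%:R))%:C * (om ^+ j) ^+ m =
    (n%:R * N%:R)^-1 * \sum_(i < n) \sum_(i' < n) (om ^+ (i + m) * (om ^+ i')^*) ^+ j.
  rewrite (rmorphM (real_complex R) (nrm (S j) ^+ 2))/= inv sqr_nrm mulrAC mulrC.
  congr (_ * _).
  rewrite /S cj_sum !mulr_suml; apply: eq_bigr => i _.
  rewrite mulr_sumr mulr_suml; apply: eq_bigr => i' _.
  rewrite exprMn -!exprM.
  by rewrite -cjX -exprM mulrAC -exprD -mulnDr [(j * _)%N]mulnC [(i' * _)%N]mulnC.
under eq_bigr do rewrite term.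
rewrite -mulr_sumr exchange_big.
have count : (\sum_(i < n) \sum_(i' < n) (i + m == i') = n - m)%N.
  have one (a : nat) : (\sum_(i' < n) (a == i') = (a < n))%N.
    have [an|na] := ltnP a n.
      rewrite (bigD1 (Ordinal an))// big1 => [|i ia].
        by rewrite [LHS]addn0 eqxx.
      by apply/eqP; rewrite eqb0 eq_sym.
    by rewrite big1// => i _; apply/eqP; rewrite eqb0 neq_ltn (leq_trans _ na) ?orbT.
  under eq_bigr do rewrite one.
  have lt_sum q : (\sum_(i < q) (i + m < n) = minn q (n - m))%N.
    elim: q => [|q IH]; first by rewrite big_ord0 min0n.
    by rewrite big_ord_recr/= IH; case: ltnP; lia.
  by rewrite lt_sum; lia.
have -> : \sum_(i < n) \sum_(j < N) \sum_(i' < n) (om ^+ (i + m) * (om ^+ i')^*) ^+ j =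
    (N%:R * (n - m)%:R : C).
  rewrite -count natr_sum mulr_sumr; apply: eq_bigr => i _.
  rewrite exchange_big natr_sum mulr_sumr; apply: eq_bigr => i' _.
  have iN : (i + m < N)%N by have := ltn_ord i; lia.
  have i'N : (i' < N)%N by have := ltn_ord i'; lia.
  by rewrite orth// natrM.
rewrite rmorphM/= fmorphV !(rmorph_nat (real_complex R)) invfM; field.
by rewrite !pnatr_eq0 -!lt0n n0 N0.
Qed.

End Fejer.

(** * Polynomial functions *)

Section PolynomialFunctions.
Variables (R : realType) (d : nat) (Omega : set 'rV[R[i]]_d).
Local Notation C := R[i].
Variable P : (Omega -> C) -> Prop.
Hypothesis P_cst : forall c, P (fun=> c).
Hypothesis P_add : forall f g, P f -> P g -> P (fun z => f z + g z).
Hypothesis P_mul : forall f g, P f -> P g -> P (fun z => f z * g z).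
Hypothesis P_coord : forall j, P (coordinate Omega j).

Lemma polynomial_sum (J : Type) (r : seq J) (f : J -> Omega -> C) :
  (forall j, P (f j)) -> P (fun z => \sum_(j <- r) f j z).
Proof.
move=> Pf; elim: r => [|j r IH].
  by under eq_fun do rewrite big_nil.
by under eq_fun do rewrite big_cons; exact: P_add.
Qed.

Lemma polynomial_prod (J : Type) (r : seq J) (f : J -> Omega -> C) :
  (forall j, P (f j)) -> P (fun z => \prod_(j <- r) f j z).
Proof.
move=> Pf; elim: r => [|j r IH].
  by under eq_fun do rewrite big_nil.
by under eq_fun do rewrite big_cons; exact: P_mul.
Qed.

Lemma polynomial_hom_part c m : P (fun z => hom_part c m (val z)).
Proof.
apply: polynomial_sum => al; apply: P_mul => //.
apply: polynomial_prod => i; elim: (al i) => [|n IH].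
  by under eq_fun do rewrite expr0.
by under eq_fun do rewrite exprS; apply: P_mul => //; exact: P_coord.
Qed.

End PolynomialFunctions.

(** * Averages over rotations *)

Section CircleAverages.
Variables (R : realType) (d : nat) (Omega : set 'rV[R[i]]_d).
Hypothesis circ : circular Omega.
Local Notation C := R[i].
Implicit Types phi psi : Omega -> C.

(** The mean of the first [n] partial sums of the homogeneous expansion: the
    subtraction of naturals is not truncated, since [m < n]. *)
Definition cesaro_mean c n (v : 'rV[C]_d) : C :=
  \sum_(0 <= m < n) ((n - m)%:R / n%:R : R)%:C * hom_part c m v.

Definition circle_average phi psi := exists N (lam : 'I_N -> C) (w : 'I_N -> R)
  (rot : 'I_N -> Omega -> Omega),
  [/\ forall j, nrm (lam j) = 1, forall j, 0 <= w j, \sum_j w j = 1,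
    forall j z, val (rot j z) = lam j *: val z &
    forall z, psi z = \sum_j (w j)%:C * phi (rot j z)].

Lemma rotation (lam : C) : nrm lam = 1 ->
  exists rot : Omega -> Omega, forall z, val (rot z) = lam *: val z.
Proof.
move=> lam1; have step (z : Omega) : exists z' : Omega, val z' = lam *: val z.
  apply: point_of; apply: (circ (lambda := lam)); first by rewrite nrmE lam1.
  by exists (val z) => //; exact: point_in.
by have [rot rotP] := choice step; exists rot.
Qed.

Lemma polydiscZ (rho : R) (lam : C) (v : 'rV[C]_d) : nrm lam = 1 ->
  polydisc rho v -> polydisc rho (lam *: v).
Proof. by move=> l1 vr i; rewrite mxE nrmM l1 mul1r. Qed.

(** A sequence of averages over finer and finer roots of unity, with Fejer
    weights of fixed order [n], converges to the Cesaro mean: the average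
    multiplies the homogeneous part of degree [m] by the [m]-th moment of the
    weights, which is the Cesaro weight for all [m] up to a bound that tends
    to infinity, and at most 1 in modulus beyond it. *)
Lemma cesaro_mean_approx phi c (rho : R) n : (0 < n)%N ->
  (forall v, polydisc rho v ->
    exists K : R, forall m, nrm (hom_part c m v) <= K / 2 ^+ m) ->
  (forall z : Omega, polydisc rho (val z) ->
    (fun n => \sum_(0 <= m < n) hom_part c m (val z)) @ \oo --> phi z) ->
  exists2 psi : nat -> Omega -> C, forall l, circle_average phi (psi l) &
    forall z, polydisc rho (val z) ->
      (fun l => psi l z) @ \oo --> cesaro_mean c n (val z).
Proof.
move=> n0 geo conv.
have step (l : nat) : exists psi : Omega -> C, circle_average phi psi /\
    forall z K, polydisc rho (val z) ->
     (forall m, nrm (hom_part c m (val z)) <= K / 2 ^+ m) ->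
     nrm (psi z - cesaro_mean c n (val z)) <= 2 * K / 2 ^+ l.
  (* With [N = 2 ^ (l + n).+1], moments of index up to [N - n] are exact, and
     [N - n] exceeds both [l] and [n]. *)
  have [lam [w [lam1 w0 mom]]] := @fejer_weights R n (l + n) n0.
  set N := (2 ^ (l + n).+1)%N in lam w lam1 w0 mom *.
  have Nbig : (2 * (l + n) < N)%N.
    by rewrite /N expnS ltn_mul2l /= ltn_expl.
  have w1 : \sum_j w j = 1.
    apply: (@complexI R); rewrite rmorph_sum /=.
    have -> : 1%:C = ((n - 0)%:R / n%:R : R)%:C.
      by rewrite subn0 divff// pnatr_eq0 -lt0n.
    by rewrite -mom; [apply: eq_bigr => j _; rewrite expr0 mulr1 | lia].
  have [rot rotP] := choice (fun j => rotation (lam1 j)).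
  exists (fun z => \sum_j (w j)%:C * phi (rot j z)); split.
    by exists N, lam, w, rot.
  move=> z K zr zK.
  pose x m := \sum_j (w j)%:C * lam j ^+ m.
  have x1 m : nrm (x m) <= 1.
    rewrite -w1; apply: le_trans (nrm_sum _ _ _) _; apply: ler_sum => j _.
    by rewrite nrmM nrmX lam1 expr1n mulr1 nrm_real ger0_norm.
  have avg : (fun M => \sum_(0 <= m < M) hom_part c m (val z) * x m) @ \oo -->
      \sum_j (w j)%:C * phi (rot j z).
    have -> : (fun M => \sum_(0 <= m < M) hom_part c m (val z) * x m) =
        (fun M => \sum_j (w j)%:C * \sum_(0 <= m < M) hom_part c m (val (rot j z))).
      apply/funext => M; under [RHS]eq_bigr do rewrite mulr_sumr.
      rewrite exchange_big; apply: eq_bigr => m _; rewrite mulr_sumr.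
      by apply: eq_bigr => j _; rewrite rotP hom_partZ mulrC mulrA.
    apply: cvg_bigsum => j; apply: cvgMl_tmp; apply: conv.
    by rewrite rotP; exact: polydiscZ.
  apply: (@nrm_cvg_le _ _ _ _ _ _ (N - n).+1 avg) => M NM.
  have K0 : 0 <= K by have := le_trans (nrm_ge0 _) (zK 0%N); rewrite expr0 divr1.
  have -> : \sum_(0 <= m < M) hom_part c m (val z) * x m - cesaro_mean c n (val z) =
      \sum_((N - n).+1 <= m < M) hom_part c m (val z) * x m.
    rewrite (big_cat_nat _ (n := (N - n).+1))//=.
    rewrite [X in X + _ - _](_ : _ = cesaro_mean c n (val z)); last first.
      rewrite [LHS](big_cat_nat _ (n := n))//=; last by lia.
      rewrite [X in _ + X]big_nat_cond [X in _ + X]big1 ?addr0 => [|m].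
        rewrite /cesaro_mean big_nat [RHS]big_nat; apply: eq_bigr => m mn.
        by rewrite mulrC /x mom//; lia.
      rewrite andbT => /andP[nm mN].
      have mnN : (m + n <= N)%N by lia.
      have nm0 : (n - m)%N = 0%N by apply/eqP; rewrite subn_eq0.
      by rewrite /x mom// nm0 mul0r mulr0.
    by rewrite addrAC subrr add0r.
  have tail := geometric_tail (x := x) (a := (N - n).+1) M zK ler01 (fun m _ => x1 m).
  apply: le_trans tail _; rewrite mul1r ler_wpM2l ?mulr_ge0//.
  by rewrite lef_pV2 ?posrE ?exprn_gt0// ler_weXn2l ?ler1n//; lia.
have [psi psiP] := choice step.
exists psi => [l|z zr]; first by case: (psiP l).
have [K KP] := geo _ zr.
have K0 : 0 <= K by have := le_trans (nrm_ge0 _) (KP 0%N); rewrite expr0 divr1.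
apply: (@cvg_le_harmonic _ _ _ _ (2 * K)) => l.
have [_ /(_ z K zr KP)/le_trans] := psiP l; apply.
rewrite ler_wpM2l ?mulr_ge0// lef_pV2 ?posrE ?exprn_gt0//.
by rewrite -natrX ler_nat ltn_expl.
Qed.

(** The Cesaro mean of order [n] differs from the partial sum by
    [n^-1 sum m hom_part c m v], and [sum m K / 2^m <= 2 K]. *)
Lemma cvg_cesaro_mean c (v : 'rV[C]_d) (l : C) (K : R) :
  (forall m, nrm (hom_part c m v) <= K / 2 ^+ m) ->
  (fun n => \sum_(0 <= m < n) hom_part c m v) @ \oo --> l ->
  (fun n => cesaro_mean c n.+1 v) @ \oo --> l.
Proof.
move=> cK cl.
have K0 : 0 <= K by have := le_trans (nrm_ge0 _) (cK 0%N); rewrite expr0 divr1.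
pose S n := \sum_(0 <= m < n) hom_part c m v.
have diff n : nrm (cesaro_mean c n.+1 v - S n.+1) <= 2 * K * n.+1%:R^-1.
  have -> : cesaro_mean c n.+1 v - S n.+1 =
      - ((n.+1%:R^-1 : R)%:C * \sum_(0 <= m < n.+1) m%:R * hom_part c m v).
    rewrite /cesaro_mean /S -sumrB mulr_sumr -sumrN.
    rewrite big_nat [RHS]big_nat; apply: eq_bigr => m mn.
    have -> : ((n.+1 - m)%:R / n.+1%:R : R)%:C = 1 - (n.+1%:R^-1 : R)%:C * m%:R.
      have mn' : (m <= n.+1)%N by lia.
      rewrite natrB// mulrBl divff ?pnatr_eq0// rmorphB rmorph1 mulrC.
      by rewrite (rmorphM (real_complex R))/= (rmorph_nat (real_complex R)).
    by ring.
  rewrite nrmN nrmM nrm_real ger0_norm ?invr_ge0// mulrC ler_wpM2r ?invr_ge0//.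
  apply: le_trans (nrm_sum _ _ _) _.
  (* The subtracted term makes the bound provable by induction: it is the exact
     tail of [sum m K / 2^m]. *)
  suff: \sum_(0 <= m < n.+1) nrm (m%:R * hom_part c m v) <=
      2 * K - 2 * K * n.+2%:R / 2 ^+ n.+1.
    by move=> /le_trans; apply; rewrite gerBl divr_ge0 ?exprn_ge0// !mulr_ge0.
  elim: n.+1 => [|q IH].
    by rewrite big_nil expr0 divr1 mulr1 subrr.
  rewrite big_nat_recr//= nrmM nrm_nat.
  have := ler_wpM2l (ler0n R q) (cK q); move: IH.
  rewrite exprS invfM; move: (2 ^- q) => y.
  rewrite -(natr1 q.+1) -(natr1 q).
  move: (\sum_(0 <= m < q) _) (nrm _) (q%:R : R) => A B x; lra.
have S1 : (fun n => S n.+1) @ \oo --> l.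
  apply/cvg_nrmP => e /((cvg_nrmP _ _).1 cl)[N NP]; exists N => n Nn.
  exact/NP/leqW.
have S0 : (fun n => cesaro_mean c n.+1 v - S n.+1) @ \oo --> (0 : C).
  by apply: (cvg_le_harmonic (K := 2 * K)) => n; rewrite subr0.
have -> : (fun n => cesaro_mean c n.+1 v) =
    (fun n => cesaro_mean c n.+1 v - S n.+1 + S n.+1).
  by apply/funext => n; rewrite subrK.
rewrite -[l]add0r; exact: cvgD S0 S1.
Qed.

End CircleAverages.

(** * Polynomial approximation of multipliers *)

Section CircularKernel.
Variables (R : realType) (d : nat) (Omega : set 'rV[R[i]]_d).
Local Notation C := R[i].
Hypotheses (domOmega : domain Omega) (circOmega : circular Omega).
Variable s : Omega -> Omega -> C.
Variable Hs : rkhs s.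
Hypothesis s_neq0 : forall z w, s z w != 0.
Hypothesis analytic_Hs : forall f : Hs, analytic (rk_eval f).
Hypothesis coord_mult : forall j, multiplier Hs (coordinate Omega j).
Hypothesis s_circle : circle_invariant s.
Variable o : Omega.
Hypothesis o0 : val o = 0.
Local Notation sec := (@rk_section _ _ _ Hs).

Let oOmega : open Omega. Proof. by case: domOmega. Qed.
Let cOmega : connected Omega. Proof. by case: domOmega. Qed.

Lemma expansion_at_origin f : analytic f ->
  exists (c : {ffun 'I_d -> nat} -> C) (rho : R), [/\ 0 < rho,
    forall v, polydisc rho v ->
      exists K : R, forall m, nrm (hom_part c m v) <= K / 2 ^+ m &
    forall z : Omega, polydisc rho (val z) ->
      (fun n => \sum_(0 <= m < n) hom_part c m (val z)) @ \oo --> f z].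
Proof.
move=> af; have [c [rho [rho0 _ geo conv]]] := analytic_expansion oOmega o af.
exists c, rho; split=> // z zr; apply: conv => //.
by rewrite o0 add0r.
Qed.

(** The function [s(., 0)] is invariant under rotations, so it equals its Fejer
    averages of order 1; these converge near 0 to the homogeneous part of
    degree 0, a constant, and the identity theorem applies. *)
Lemma section_origin_constant : exists l : C, forall z, rk_eval (sec o) z = l.
Proof.
pose f := rk_eval (sec o); have af : analytic f by exact: analytic_Hs.
have [c [rho [rho0 geo conv]]] := expansion_at_origin af.
have [psi psi_avg psi_lim] := cesaro_mean_approx circOmega (ltn0Sn 0) geo conv.
exists (hom_part c 0 0); apply: (identity_theorem oOmega (b := o) cOmega af).
exists rho => // z; rewrite o0 subr0 => zr.
have inv l : psi l z = f z.
  have [N [lam [w [rot [lam1 w0 w1 rotP ->]]]]] := psi_avg l.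
  have frot j : f (rot j z) = f z.
    rewrite /f !rk_sectionE; apply: (s_circle (lambda := lam j)).
    - by rewrite nrmE lam1.
    - exact: rotP.
    - by rewrite o0 scaler0.
  under eq_bigr do rewrite frot.
  by rewrite -mulr_suml -rmorph_sum/= w1 mul1r.
have := psi_lim z zr; under eq_fun do rewrite inv.
move=> lim; have <- : cesaro_mean c 1 (val z) = f z.
  by apply: cvg_nrm_unique lim _; exact: cvg_cst.
rewrite /cesaro_mean big_nat1 subn0 divr1 mul1r.
by rewrite -[X in _ = hom_part c 0 X](scale0r (val z)) hom_partZ expr0 mul1r.
Qed.

(** Multipliers are thereby elements of the space, in particular analytic. *)
Lemma one_in_space : exists one : Hs, forall z, rk_eval one z = 1.
Proof.
have [l lE] := section_origin_constant; exists (l^-1 *: sec o) => z.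
rewrite evalZ lE mulVf//; have := s_neq0 z o.
by rewrite -(@rk_sectionE _ _ _ Hs) lE.
Qed.

(** By the identity theorem, the kernel functions of points near 0 are total.
    Hence norm bounds and limits have to be checked near 0 only, where
    functions are the sums of their power series. *)
Lemma total_polydisc (rho : R) : 0 < rho ->
  total_family (sec \o (@sval Omega (fun z => polydisc rho (val z)))).
Proof.
move=> rho0 g g0; apply: total_sections => z; rewrite rk_reproducing.
apply: (identity_theorem oOmega (b := o) cOmega (analytic_Hs g)).
exists rho => // x; rewrite o0 subr0 => xr.
by have := g0 (exist _ x xr); rewrite /= rk_reproducing.
Qed.

(** Rotation invariance of [s] gives each rotate of [phi] the same multiplier
    norm, and the norm is convex. *)
Lemma dual_bound_average phi psi (c : R) : 0 <= c ->
  dual_bound sec phi c -> circle_average phi psi -> dual_bound sec psi c.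
Proof.
move=> c0 b [N [lam [w [rot [lam1 w0 w1 rotP /funext ->]]]]].
apply: dual_bound_convex => // j.
move/(dual_bound_kernel _ _ c0): b => /(kernel_comp (rot j)) b.
apply/(dual_bound_kernel _ _ c0); apply: kernel_ext b => x y.
have lam1' : `|lam j| = 1 by rewrite nrmE lam1.
by rewrite !gram_sections (s_circle lam1' (rotP j x) (rotP j y)).
Qed.

(** Near 0, the Cesaro means of the expansion of [phi] are limits of averages
    of rotates of [phi], so they inherit the bound [c] there; being polynomials
    they are multipliers, and the bound extends to [Omega] by totality.  They
    converge to [phi] near 0, and everywhere because, applied to the constant
    function 1, they form a bounded sequence in [Hs]. *)
Theorem polynomial_approximation phi : multiplier Hs phi ->
  exists (c : R) (coef : {ffun 'I_d -> nat} -> C), [/\ 0 <= c,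
    dual_bound sec phi c,
    forall n, dual_bound sec (fun z => cesaro_mean coef n.+1 (val z)) c &
    forall z, (fun n => cesaro_mean coef n.+1 (val z)) @ \oo --> phi z].
Proof.
move=> mphi; have [c c0 bphi] := multiplier_dual_bound mphi.
have [one oneE] := one_in_space; have [f fE] := mphi one.
have phiE : phi = rk_eval f by apply/funext => z; rewrite fE oneE mulr1.
have aphi : analytic phi by rewrite phiE; exact: analytic_Hs.
have [coef [rho [rho0 geo conv]]] := expansion_at_origin aphi.
pose sigma n (z : Omega) := cesaro_mean coef n.+1 (val z).
have tD := total_polydisc rho0.
have bsigma n : dual_bound sec (sigma n) c.
  have [psi psi_avg psi_lim] := cesaro_mean_approx circOmega (ltn0Sn n) geo conv.
  have bpsi l : dual_bound sec (psi l) c by exact: dual_bound_average (psi_avg l).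
  apply: (dual_bound_extend c0 tD) => [|F].
    apply: (dual_bound_lim (a := fun l => psi l \o sval)) => [l|[z zr]].
      exact: dual_bound_sub.
    exact: psi_lim.
  have msigma : multiplier Hs (sigma n).
    apply: polynomial_sum => [||m]; [exact: multiplier_cst | exact: multiplierD|].
    apply: multiplierM; first exact: multiplier_cst.
    by apply: polynomial_hom_part coord_mult _ _;
      [exact: multiplier_cst | exact: multiplierD | exact: multiplierM].
  have [G GE] := msigma F; exists G => z.
  by rewrite !rk_reproducing GE.
exists c, coef; split=> // z.
have [u uP] := choice (fun n => dual_bound_op c0 (bsigma n) one).
have uE n x : rk_eval (u n) x = sigma n x.
  by have [h _] := uP n; rewrite -rk_reproducing h rk_reproducing oneE mulr1.
have innerE n x : inner (u n) (sec x) = sigma n x by rewrite rk_reproducing uE.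
have lim : (fun n => inner (u n) (sec z)) @ \oo --> inner f (sec z).
  apply: (cvg_inner_total (K := c * nrm one) tD) => [n|[x xr]].
    by case: (uP n).
  rewrite /= rk_reproducing -phiE; under eq_fun do rewrite innerE.
  by have [K KP] := geo _ xr; apply: cvg_cesaro_mean KP _; exact: conv.
by move: lim; rewrite rk_reproducing -phiE; under eq_fun do rewrite innerE.
Qed.

End CircularKernel.

(** * Invariant subspaces *)

Theorem proposition2p5 (R : realType) (d : nat) (Omega : set 'rV[R[i]]_d)
    (domOmega : domain Omega) (circOmega : circular Omega)
    (Omega0 : Omega 0)
    (k s : Omega -> Omega -> R[i])
    (kernel_k : is_kernel k) (kernel_s : is_kernel s)
    (s_neq0 : forall z w, s z w != 0)
    (kernel_ks : is_kernel (fun z w => k z w / s z w))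
    (Hk : rkhs k) (Hs : rkhs s)
    (E : hilbertType R) (HkE : hilbert_tensor Hk E)
    (analytic_Hs : forall f : Hs, analytic (rk_eval f))
    (coord_mult : forall j : 'I_d, multiplier Hs (coordinate Omega j))
    (s_circle : circle_invariant s)
    (M : set HkE) (M_closed : closed_subspace M) :
  mult_invariant Hs M <->
  forall j : 'I_d, invariant_under M (coordinate Omega j).
Proof.
split=> [inv j|inv phi mphi]; first exact: inv.
have [o o0] := point_of Omega0.
have [c [coef [c0 bphi bsigma lim]]] := polynomial_approximation domOmega
  circOmega s_neq0 analytic_Hs coord_mult s_circle o0 mphi.
have bk psi : dual_bound (@rk_section _ _ _ Hs) psi c ->
    dual_bound (@rk_section _ _ _ Hk) psi c.
  exact: dual_bound_quotient.
have [A [B [Aphi BA Bc]]] := dual_bound_tensor_op c0 (bk _ bphi)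
  (dual_bound_tensor HkE c0 (bk _ bphi)).
exists A, B; split=> // _ [F MF <-].
pose v := tensor_section HkE.
(* The vector [G] is the product of [F] by [psi], tested on the total family. *)
pose acts (psi : Omega -> R[i]) := forall F, M F ->
  exists G, M G /\ forall p, inner G (v p) = psi p.1 * inner F (v p).
have acts_cst a : acts (fun=> a).
  move=> F' MF'; exists (a *: F'); split; first exact: subspaceZ.
  by move=> p; rewrite innerZl.
have actsD f g : acts f -> acts g -> acts (fun z => f z + g z).
  move=> af ag F' MF'; have [G [MG GE]] := af F' MF'.
  have [G' [MG' GE']] := ag F' MF'.
  exists (G + G'); split; first exact: subspaceD.
  by move=> p; rewrite innerDl GE GE' mulrDl.
have actsM f g : acts f -> acts g -> acts (fun z => f z * g z).
  move=> af ag F' MF'; have [G [MG GE]] := ag F' MF'.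
  have [G' [MG' GE']] := af G MG; exists G'; split=> // p.
  by rewrite GE' GE mulrA.
have acts_coord j : acts (coordinate Omega j).
  move=> F' MF'; have [A' [B' [A'P B'P B'M]]] := inv j.
  exists (B' F'); split; first by apply: B'M; exists F'.
  exact: tensor_mult_inner.
have acts_sigma n : acts (fun z => cesaro_mean coef n.+1 (val z)).
  apply: (polynomial_sum (P := acts)) => // m; apply: (actsM) => //.
  exact: (polynomial_hom_part acts_cst actsD actsM acts_coord).
have [u uP] := choice (fun n => acts_sigma n F MF).
apply: (subspace_weak_closed M_closed (v := v) (u := u) (K := c * nrm F)).
- exact: total_tensor_sections.
- by move=> n; case: (uP n).
- move=> n.
  have bT := dual_bound_tensor HkE c0 (bk _ (bsigma n)).
  have [G [GP Gc]] := dual_bound_op c0 bT F; suff -> : u n = G by [].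
  apply: (inner_ext (@total_tensor_sections _ _ _ _ _ HkE)) => p.
  by rewrite GP; case: (uP n).
- move=> p; rewrite (tensor_mult_inner Aphi BA).
  have uE n : inner (u n) (v p) = cesaro_mean coef n.+1 (val p.1) * inner F (v p).
    by case: (uP n).
  under eq_fun do rewrite uE.
  by apply: cvgMr_tmp; exact: lim.
Qed.
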